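(* Assume that each $m_i$ is $\delta_i$-Ahlfors regular and that $\{\mathcal R_{\alpha,i}\}_{\alpha\in J}$ has the $\kappa$-scaling property for each $1\le i\le d$. Let $\mathbf a\in(0,\infty)^d$ and suppose $$m\Big(\limsup_{\alpha\in J,\ \beta_\alpha\to\infty}\Delta(\mathcal R_\alpha,\rho(\beta_\alpha)^{\mathbf a})\Big)=m(X),$$ i.e. $m$-almost every $x\in X$ lies in $\Delta(\mathcal R_\alpha,\rho(\beta_\alpha)^{\mathbf a})$ for infinitely many $\alpha\in J$. Then for every $\mathbf t\in(0,\infty)^d$, $\dim_HW(\mathbf t)\ge s(\mathbf t)$.
   Context: Fix an integer $d\ge1$. For each $1\le i\le d$, $(X_i,|\cdot|_i)$ is a bounded locally compact metric space carrying a Borel probability measure $m_i$. The measure $m_i$ is $\delta_i$-Ahlfors regular ($\delta_i>0$) if there are constants $c,C,r_0>0$ with $c\,r^{\delta_i}\le m_i(B(x,r))\le C\,r^{\delta_i}$ for all $x\in X_i$ and $0<r\le r_0$. Put $X=\prod_{i=1}^dX_i$ with metric $|x-y|=\max_i|x_i-y_i|_i$ and measure $m=\prod_i m_i$; thus a ball in $X$ is $B(x,r)=\prod_iB(x_i,r)$. For $E\subset X_i$ and $\epsilon>0$, $\Delta(E,\epsilon)=\{y\in X_i:\operatorname{dist}(y,E)<\epsilon\}$. $J$ is an infinite countable index set and $\beta:J\to(0,\infty)$, $\alpha\mapsto\beta_\alpha$, satisfies: $\{\alpha:\beta_\alpha<M\}$ is finite for every $M>1$. $\rho:(0,\infty)\to(0,\infty)$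 is non-increasing with $\rho(u)\to0$ as $u\to\infty$. For each $i$, $\{\mathcal R_{\alpha,i}:\alpha\in J\}$ are subsets of $X_i$ and $\mathcal R_\alpha=\prod_i\mathcal R_{\alpha,i}$. For $\mathbf b=(b_1,\dots,b_d)\in(0,\infty)^d$ and $r>0$, $\Delta(\mathcal R_\alpha,r^{\mathbf b})=\prod_{i=1}^d\Delta(\mathcal R_{\alpha,i},r^{b_i})$. $\kappa$-scaling property ($0\le\kappa<1$): there are constants $c_2,c_3>0$ such that for every $\alpha\in J$, every $x_i\in\mathcal R_{\alpha,i}$ and every $0<\epsilon<r$ (with $r$ sufficiently small), $c_2r^{\delta_i\kappa}\epsilon^{\delta_i(1-\kappa)}\le m_i(B(x_i,r)\cap\Delta(\mathcal R_{\alpha,i},\epsilon))\le c_3r^{\delta_i\kappa}\epsilon^{\delta_i(1-\kappa)}$. For $\mathbf t\in[0,\infty)^d$: $W(\mathbf t)=\{x\in X: x\in\Delta(\mathcal R_\alpha,\rho(\beta_\alpha)^{\mathbf a+\mathbf t})\text{ for infinitely many }\alpha\in J\}$. Dimensional number: let $\mathcal A=\{a_i,\ a_i+t_i:1\le i\le d\}$. For $A\in\mathcal A$ let $\mathcal K_1=\{k:a_k\ge A\}$, $\mathcal K_2=\{k:a_k+t_k\le A\}\setminus\mathcal K_1$, $\mathcal K_3=\{1,\dots,d\}\setminus(\mathcal K_1\cup\mathcal K_2)$, and $$s(\mathbf t)=\min_{A\in\mathcal A}\Big\{\sum_{k\in\mathcal K_1}\delta_k+\sum_{k\in\mathcal K_2}\delta_k+\kappa\sum_{k\in\mathcal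 K_3}\delta_k+(1-\kappa)\frac{\sum_{k\in\mathcal K_3}a_k\delta_k-\sum_{k\in\mathcal K_2}t_k\delta_k}{A}\Big\}.$$ *)

(* Defs.v *)
From HB Require Import structures.
From mathcomp Require Import all_boot all_order all_algebra.
From mathcomp Require Import all_classical all_reals all_analysis.
Set Implicit Arguments. Unset Strict Implicit. Unset Printing Implicit Defensive.
Import Order.TTheory GRing.Theory Num.Theory numFieldNormedType.Exports.
Local Open Scope classical_set_scope.
Local Open Scope ring_scope.

Section MetricNotions.
Variables (R : realType) (T : Type) (dist : T -> T -> R).

Definition is_metric : Prop :=
  (forall x y, 0 <= dist x y) /\ (forall x y, dist x y = 0 <-> x = y) /\
  (forall x y, dist x y = dist y x) /\
  (forall x y z, dist x z <= dist x y + dist y z).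

Definition bounded_metric : Prop := exists M : R, forall x y, dist x y <= M.

Definition oball (x : T) (r : R) : set T := [set y | dist x y < r].

Definition dopen (A : set T) : Prop :=
  forall x, A x -> exists2 r : R, 0 < r & oball x r `<=` A.

(* compactness (sequential compactness, equivalent to compactness in metric spaces) *)
Definition dcompact (K : set T) : Prop :=
  forall u : nat -> T, (forall n, K (u n)) ->
    exists phi : nat -> nat, (forall n, (phi n < phi n.+1)%N) /\
      exists2 y, K y & (fun n => dist (u (phi n)) y) @ \oo --> 0.

Definition dlocally_compact : Prop :=
  forall x, exists2 K, dcompact K & exists2 r : R, 0 < r & oball x r `<=` K.

Definition dborel (A : set T) : Prop := <<s dopen >> A.

(* Borel probability measure (values outside Borel sets are irrelevant) *)
Definition borel_prob_measure (mu : set T -> \bar R) : Prop :=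
  mu set0 = 0%E /\ (forall A, dborel A -> (0 <= mu A)%E) /\
  (forall F : nat -> set T, (forall n, dborel (F n)) -> trivIset setT F ->
     (\sum_(0 <= n <oo) mu (F n))%E = mu (\bigcup_n F n)) /\
  mu setT = 1%E.

Definition ahlfors_regular (mu : set T -> \bar R) (delta : R) : Prop :=
  exists c C r0 : R, [/\ 0 < c, 0 < C, 0 < r0 &
    forall x r, 0 < r <= r0 ->
      ((c * r `^ delta)%:E <= mu (oball x r) <= (C * r `^ delta)%:E)%E].

(* dist(y, E) = inf_{z in E} |y - z| (+oo if E is empty) *)
Definition dist_set (y : T) (E : set T) : \bar R :=
  ereal_inf [set (dist y z)%:E | z in E].

Definition nbhdset (E : set T) (eps : R) : set T :=
  [set y | (dist_set y E < eps%:E)%E].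

Definition ddiam (U : set T) : \bar R :=
  ereal_sup [set (dist x y)%:E | x in U & y in U].

(* |U|^s, with the empty set contributing 0 *)
Definition diam_pow (s : R) (e : \bar R) : \bar R :=
  match e with
  | EFin r => (r `^ s)%:E
  | +oo%E => +oo%E
  | -oo%E => 0%E
  end.

Definition hausdorff_content (s eta : R) (E : set T) : \bar R :=
  ereal_inf [set (\sum_(0 <= n <oo) diam_pow s (ddiam (U n)))%E
            | U in [set U : nat -> set T |
                     E `<=` \bigcup_n U n /\ forall n, (ddiam (U n) <= eta%:E)%E]].

Definition hausdorff_measure (s : R) (E : set T) : \bar R :=
  ereal_sup [set hausdorff_content s eta E | eta in [set eta : R | 0 < eta]].

Definition hausdorff_dim (E : set T) : \bar R :=
  ereal_inf [set s%:E | s in [set s : R | 0 < s /\ hausdorff_measure s E = 0%E]].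

End MetricNotions.

Section Product.
Variables (R : realType) (d : nat) (T : 'I_d -> Type)
  (dist : forall i, T i -> T i -> R).

Definition prod_dist (x y : forall i, T i) : R :=
  \big[Order.max/0]_(i < d) dist (x i) (y i).

Definition drect (A : forall i, set (T i)) : set (forall i, T i) :=
  [set x | forall i, A i (x i)].

(* m is the product measure of the m_i: a Borel probability measure on X
   agreeing with prod_i m_i on Borel rectangles (this determines it). *)
Definition is_product_measure (mi : forall i, set (T i) -> \bar R)
  (m : set (forall i, T i) -> \bar R) : Prop :=
  borel_prob_measure prod_dist m /\
  forall A : forall i, set (T i), (forall i, dborel (@dist i) (A i)) ->
    m (drect A) = (\prod_(i < d) mi i (A i))%E.

End Product.

Section Problem.
Variables (R : realType) (d : nat) (T : 'I_d -> Type)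
  (dist : forall i, T i -> T i -> R) (J : Type).

Definition kappa_scaling (i : 'I_d) (mu : set (T i) -> \bar R) (delta kappa : R)
  (Rset : J -> set (T i)) : Prop :=
  exists c2 c3 r1 : R, [/\ 0 < c2, 0 < c3, 0 < r1 &
    forall alpha x eps r, Rset alpha x -> 0 < eps -> eps < r -> r <= r1 ->
      ((c2 * r `^ (delta * kappa) * eps `^ (delta * (1 - kappa)))%:E
         <= mu (oball (@dist i) x r `&` nbhdset (@dist i) (Rset alpha) eps)
         <= (c3 * r `^ (delta * kappa) * eps `^ (delta * (1 - kappa)))%:E)%E].

Definition limsup_set (Rset : forall i, J -> set (T i)) (beta : J -> R)
  (rho : R -> R) (b : 'I_d -> R) : set (forall i, T i) :=
  [set x | infinite_set [set alpha |
     forall i, nbhdset (@dist i) (Rset i alpha) (rho (beta alpha) `^ b i) (x i)]].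

End Problem.

Arguments kappa_scaling [R d T] dist [J] i mu delta kappa Rset.

Definition dim_value (R : realType) (d : nat) (delta a t : 'I_d -> R) (kappa A : R) : R :=
  let K1 := fun k : 'I_d => A <= a k in
  let K2 := fun k : 'I_d => (a k + t k <= A) && ~~ (A <= a k) in
  let K3 := fun k : 'I_d => ~~ K1 k && ~~ K2 k in
  (\sum_(k < d | K1 k) delta k) + (\sum_(k < d | K2 k) delta k)
  + kappa * (\sum_(k < d | K3 k) delta k)
  + (1 - kappa) * ((\sum_(k < d | K3 k) a k * delta k)
                   - (\sum_(k < d | K2 k) t k * delta k)) / A.

Definition dim_number (R : realType) (d : nat) (delta a t : 'I_d -> R) (kappa : R)
  : \bar R :=
  ereal_inf [set (dim_value delta a t kappa A)%:E
            | A in [set A : R | exists i : 'I_d, A = a i \/ A = a i + t i]].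

(* Main.v *)
Require Import Defs.
From HB Require Import structures.
From mathcomp Require Import all_boot all_order all_algebra.
From mathcomp Require Import all_classical all_reals all_analysis.
From mathcomp Require Import ring lra.
Set Implicit Arguments. Unset Strict Implicit. Unset Printing Implicit Defensive.
Import Order.TTheory GRing.Theory Num.Theory numFieldNormedType.Exports.
Local Open Scope classical_set_scope.
Local Open Scope ring_scope.

(* Fix s' below the dimensional number.  Round rho(beta_alpha) up to a dyadic
   u = 2^-k.  Inside any ball B, full measure and a Vitali selection, run level
   by level (rectangles with sides u^a_i behave like balls of a quasi-metric),
   give disjoint rectangles prod_i B(z_i, u^a_i), z in R_alpha, which carry a
   fixed proportion of m(B).  Spread the mass of each of them uniformly over its
   part inside Delta(R_alpha, (u/2)^(a+t)).  If r = u^A, the rectangles of level k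
   give to a ball of radius r at most a constant times u^E(A), where E(A)/A is
   the expression minimised in the dimensional number; E is affine between
   breakpoints, so E(A) >= A s(t) for all A > 0.  As s' < s(t), the bounds for
   the levels with some side longer than r sum to a geometric series; the
   remaining rectangles are handled together, by disjointness.

   Iterating this redistribution at rapidly decreasing scales costs a factor
   close to 1 at each step, since below the scale of the redistribution there is
   room between s and s'.  This yields nested sets S_n, with limit inside W(t),
   and set functions mu_n on S_n of constant total mass with
   mu_n(B(x,r)) <= 2 r^s, whence H^s(W(t)) > 0.  The mu_n are finite
   combinations of restrictions of m, so no integral or limit measure occurs. *)

(** * Borel sets and finitely additive set functions *)

(** Nothing is known about how the values [rho (beta alpha)] are spread over the dyadic levels, so a
    selection inside one ball may mix any number of levels, and every estimate must be uniform in
    that number. Let Q be the sum of the delta_i. Rectangles with all sides at most r are harmless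
    because disjointness bounds their total volume near a ball of radius r by a constant times r^Q.
    If some side is longer than r = u^A, then A is at least min a_i, so the linear gap (s' - s) A is
    bounded below by a positive constant; this constant is the source of the geometric ratio. A gap
    between exponents is consumed twice, here and in the iteration. The iteration works because each
    set function has bounded density with respect to m: a cell of size h then has mass of order h^Q,
    which cancels the normalisation of the mass redistributed inside it. *)

Section Borel.
Variables (R : realType) (X : Type) (D : X -> X -> R).

Lemma dborel_open A : dopen D A -> dborel D A.
Proof. exact: sub_sigma_algebra. Qed.

Lemma dborel0 : dborel D set0.
Proof. exact: sigma_algebra0. Qed.

Lemma dborelC A : dborel D A -> dborel D (~` A).
Proof. by rewrite -setTD; exact: sigma_algebraCD. Qed.

Lemma dborelT : dborel D setT.
Proof. by rewrite -setC0; apply: dborelC; exact: dborel0. Qed.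

Lemma dborel_bigcup (F : nat -> set X) :
  (forall n, dborel D (F n)) -> dborel D (\bigcup_n F n).
Proof. exact: sigma_algebra_bigcup. Qed.

Lemma dborel_bigcap (F : nat -> set X) :
  (forall n, dborel D (F n)) -> dborel D (\bigcap_n F n).
Proof.
move=> h; rewrite -[X in dborel _ X]setCK setC_bigcap.
by apply: dborelC; apply: dborel_bigcup => n; apply: dborelC.
Qed.

Lemma dborelU A B : dborel D A -> dborel D B -> dborel D (A `|` B).
Proof.
move=> hA hB; rewrite -bigcup2E; apply: dborel_bigcup => -[|[|n]] //=.
exact: dborel0.
Qed.

Lemma dborelI A B : dborel D A -> dborel D B -> dborel D (A `&` B).
Proof.
by move=> hA hB; rewrite -[A `&` B]setCK setCI; apply: dborelC; apply: dborelU;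
  apply: dborelC.
Qed.

Lemma dborelD A B : dborel D A -> dborel D B -> dborel D (A `\` B).
Proof. by move=> hA hB; rewrite setDE; apply: dborelI => //; apply: dborelC. Qed.

Lemma dborel_bigcup_lt (n : nat) (F : nat -> set X) :
  (forall i, (i < n)%N -> dborel D (F i)) ->
  dborel D [set x | exists2 i, (i < n)%N & F i x].
Proof.
move=> hF.
have -> : [set x | exists2 i, (i < n)%N & F i x] =
    \bigcup_i (if (i < n)%N then F i else set0).
  apply/seteqP; split => x /=.
    by move=> [i hi Fi]; exists i => //; rewrite hi.
  by move=> [i _]; case: ifP => // hi Fi; exists i.
by apply: dborel_bigcup => i; case: ifP => hi; [exact: hF|exact: dborel0].
Qed.

Lemma dopen_bigcup I (P : set I) (F : I -> set X) :
  (forall i, P i -> dopen D (F i)) -> dopen D (\bigcup_(i in P) F i).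
Proof.
move=> h x [i Pi Fx]; have [r r0 hr] := h _ Pi _ Fx.
by exists r => // y /hr ?; exists i.
Qed.

Lemma dopenI A B : dopen D A -> dopen D B -> dopen D (A `&` B).
Proof.
move=> hA hB x [/hA[r r0 hr] /hB[s s0 hs]].
exists (Num.min r s); first by rewrite lt_min r0.
by move=> y; rewrite /oball /= lt_min => /andP[? ?]; split; [apply: hr|apply: hs].
Qed.

(** Finite additivity on Borel sets survives restriction and finite nonnegative combinations, the
    only operations by which the set functions are built. *)
Definition fcontent (mu : set X -> R) :=
  (forall A, dborel D A -> 0 <= mu A) /\
  (forall A B, dborel D A -> dborel D B -> A `&` B = set0 ->
     mu (A `|` B) = mu A + mu B).

Section Content.
Variable mu : set X -> R.
Hypothesis muP : fcontent mu.

Lemma fcontent_ge0 A : dborel D A -> 0 <= mu A. Proof. exact: muP.1. Qed.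

Lemma fcontent0 : mu set0 = 0.
Proof.
have := muP.2 set0 set0 dborel0 dborel0 (setI0 _).
by rewrite setU0 => /eqP; rewrite -subr_eq0 opprD addNKr oppr_eq0 => /eqP.
Qed.

Lemma fcontentID A B : dborel D A -> dborel D B ->
  mu A = mu (A `&` B) + mu (A `\` B).
Proof.
move=> hA hB; rewrite -muP.2 ?setUIDK //; first exact: dborelI.
  exact: dborelD.
by apply/seteqP; split => x // -[[? ?] []].
Qed.

Lemma fcontent_le A B : dborel D A -> dborel D B -> A `<=` B -> mu A <= mu B.
Proof.
move=> hA hB AB; rewrite (fcontentID hB hA) (setIidr AB) lerDl.
by apply: fcontent_ge0; exact: dborelD.
Qed.

(** Induction on [n]: [F n] is split off, and the rest of [A] is covered by the earlier sets. The
    predicate [P] selects a subfamily without renumbering it. *)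
Lemma fcontent_cover n A (F : nat -> set X) (P : pred nat) : dborel D A ->
  (forall i, (i < n)%N -> dborel D (F i)) ->
  (forall x, A x -> exists i, [/\ (i < n)%N, P i & F i x]) ->
  mu A <= \sum_(i < n | P i) mu (F i).
Proof.
elim: n A => [|n IH] A hA hF hc.
  rewrite big_ord0 (_ : A = set0) ?fcontent0 //.
  by apply/seteqP; split => x // /hc[i []].
have hFn : dborel D (F n) by exact: hF.
have hF' i : (i < n)%N -> dborel D (F i) by move=> /ltnW hi; exact: hF.
rewrite big_mkcond big_ord_recr -big_mkcond /=; case: ifP => Pn.
  rewrite (fcontentID hA hFn) addrC lerD //.
    by apply: fcontent_le => //; exact: dborelI.
  apply: IH => //; first exact: dborelD.
  move=> x [/hc[i [hi Pi Fi]] nF]; exists i; split => //.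
  by move: hi; rewrite ltnS leq_eqVlt => /orP[/eqP E|//]; subst i.
rewrite addr0; apply: IH => // x /hc[i [hi Pi Fi]]; exists i; split => //.
by move: hi; rewrite ltnS leq_eqVlt => /orP[/eqP E|//]; subst i; rewrite Pi in Pn.
Qed.

Lemma fcontent_packing n A (F : nat -> set X) (P : pred nat) : dborel D A ->
  (forall i, (i < n)%N -> P i -> dborel D (F i) /\ F i `<=` A) ->
  (forall i j, (i < j < n)%N -> P i -> P j -> F i `&` F j = set0) ->
  \sum_(i < n | P i) mu (F i) <= mu A.
Proof.
elim: n A => [|n IH] A hA hF hd; first by rewrite big_ord0 fcontent_ge0.
have hd' i j : (i < j < n)%N -> P i -> P j -> F i `&` F j = set0.
  by move=> /andP[? /ltnW ?]; apply: hd; apply/andP.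
rewrite big_mkcond big_ord_recr -big_mkcond /=; case: ifP => Pn; last first.
  by rewrite addr0; apply: IH => // i /ltnW; exact: hF.
have [hFn sFn] := hF n (ltnSn n) Pn.
rewrite (fcontentID hA hFn) (setIidr sFn) addrC lerD2l; apply: IH => //.
  exact: dborelD.
move=> i hi Pi; have [? sF] := hF i (ltnW hi) Pi; split => // x Fx; split.
  exact: sF.
move=> Fnx; suff: (F i `&` F n) x by rewrite hd // hi /=.
by [].
Qed.

End Content.

Lemma fcontent_restrict mu B : fcontent mu -> dborel D B ->
  fcontent (fun A => mu (A `&` B)).
Proof.
move=> hmu hB; split=> [A hA|A A' hA hA' AA']; first by apply: hmu.1; exact: dborelI.
rewrite setIUl hmu.2 //; try exact: dborelI.
by rewrite setIACA AA' set0I.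
Qed.

Lemma fcontent_sum n (P : pred nat) (w : nat -> R) (mu : nat -> set X -> R) :
  (forall i, (i < n)%N -> P i -> 0 <= w i) ->
  (forall i, (i < n)%N -> P i -> fcontent (mu i)) ->
  fcontent (fun A => \sum_(i < n | P i) w i * mu i A).
Proof.
move=> w0 hmu; split=> [A hA|A B hA hB AB].
  by apply: sumr_ge0 => i Pi; rewrite mulr_ge0 ?w0 //; apply: (hmu i _ Pi).1.
rewrite -big_split /=; apply: eq_bigr => i Pi.
by rewrite (hmu i _ Pi).2 // mulrDr.
Qed.

End Borel.

(** * Probability measures as real-valued contents *)

Section Mass.
Variables (R : realType) (X : Type) (D : X -> X -> R) (m : set X -> \bar R).
Hypothesis mP : borel_prob_measure D m.

Definition mass (A : set X) : R := fine (m A).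

Lemma measure_additive A B : dborel D A -> dborel D B -> A `&` B = set0 ->
  m (A `|` B) = (m A + m B)%E.
Proof.
case: mP => m0 [mge0 [msig mT]] hA hB AB.
rewrite -bigcup2E -msig.
- rewrite (nneseries_split 0 2); last first.
    by move=> n _; apply: mge0; case: n => [|[|n]] //=; exact: dborel0.
  rewrite add0n eseries0 ?adde0.
    by rewrite !big_nat_recr //= big_geq // add0e.
  by move=> [|[|n]].
- by move=> [|[|n]] //=; exact: dborel0.
- move=> i j _ _; rewrite /bigcup2.
  case: i => [|[|i]]; case: j => [|[|j]] //=; rewrite ?AB ?set0I ?setI0;
    try by move=> [x].
  by rewrite setIC AB => -[].
Qed.

(** The values on a Borel set and on its complement are nonnegative with sum 1, hence finite; from
    here on the arithmetic is real. *)
Lemma measure_fin A : dborel D A -> m A = (mass A)%:E.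
Proof.
move=> hA; have [m0 [mge0 [msig mT]]] := mP.
have hC := dborelC hA.
have := measure_additive hA hC (setICr _).
rewrite setUCr mT /mass; have := mge0 _ hA; have := mge0 _ hC.
by case: (m A) (m (~` A)) => [a| |] [b| |].
Qed.

Lemma mass_content : fcontent D mass.
Proof.
have [m0 [mge0 [msig mT]]] := mP; split=> [A hA|A B hA hB AB].
  by rewrite -lee_fin -measure_fin //; exact: mge0.
apply/EFin_inj; rewrite -measure_fin; last exact: dborelU.
by rewrite measure_additive // !measure_fin.
Qed.

Lemma massT : mass setT = 1.
Proof. by rewrite /mass mP.2.2.2. Qed.

Lemma mass_le1 A : dborel D A -> mass A <= 1.
Proof.
move=> hA; rewrite -massT; apply: (fcontent_le mass_content) => //.
exact: dborelT.
Qed.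

(** Continuity from below: after disjointification by [seqDU] some partial sum exceeds [1 - e],
    since otherwise the limit 1 would not. *)
Lemma mass_bigcup_approx (F : nat -> set X) (e : R) : 0 < e ->
  (forall n, dborel D (F n)) -> mass (\bigcup_n F n) = 1 ->
  exists n, 1 - e < mass [set x | exists2 i, (i < n)%N & F i x].
Proof.
move=> e0 hF h1.
pose G := seqDU F.
have hG n : dborel D (G n).
  rewrite /G /seqDU; apply: dborelD => //.
  have -> : \big[setU/set0]_(k < n) F k = [set x | exists2 i, (i < n)%N & F i x].
    by rewrite -bigcup_mkord; apply/seteqP; split => x [i ? ?]; exists i.
  by apply: dborel_bigcup_lt => i _.
have hs := mP.2.2.1 G hG (@trivIset_seqDU _ F).
rewrite -seqDU_bigcup_eq measure_fin in hs; last exact: dborel_bigcup.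
rewrite h1 in hs.
have [n hn] : exists n, ((1 - e)%:E < \sum_(0 <= k < n) m (G k))%E.
  apply: contrapT => /forallNP hno.
  have : (1%:E <= (1 - e)%:E :> \bar R)%E.
    rewrite -hs; apply: lime_le.
      by apply: is_cvg_nneseries => n _ _; exact: mP.2.1.
    by apply: nearW => n; rewrite leNgt; apply/negP; exact: hno.
  by rewrite lee_fin; lra.
exists n; rewrite -lte_fin; apply: (lt_le_trans hn).
rewrite big_mkord.
under eq_bigr do rewrite measure_fin //.
rewrite sumEFin lee_fin.
apply: (fcontent_packing mass_content (P := xpredT) (F := G)).
- by apply: dborel_bigcup_lt.
- by move=> i hi _; split => // x [Fx _]; exists i.
- move=> i j /andP[ij _] _ _; apply/seteqP; split => x //= -[Gi Gj].
  have := @trivIset_seqDU _ F i j I I; rewrite -/G.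
  by move=> h; move: ij; rewrite h ?ltnn //; exists x.
Qed.

End Mass.

(** * Separated families and the mass distribution principle *)

Section Separated.
Variables (T : Type) (sep : T -> T -> Prop).

Definition sep_family (Q : T -> Prop) n (z : nat -> T) :=
  (forall i, (i < n)%N -> Q (z i)) /\
  (forall i j, (i < j < n)%N -> sep (z i) (z j)).

(** The bound [B] on the length of separated families makes the greedy extension stop; the recursion
    is on the room [B - n0]. Old elements keep their indices, so that levels can be appended one
    after another. *)
Lemma extend_separated (Q P : T -> Prop) (B : nat) :
  (forall x, P x -> Q x) ->
  (forall n z, sep_family Q n z -> (n <= B)%N) ->
  forall n0 z0, sep_family Q n0 z0 ->
  exists n z, [/\ sep_family Q n z,
    forall i, (i < n)%N -> P (z i) \/ exists2 j, (j < n0)%N & z i = z0 j,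
    forall i, (i < n0)%N -> (i < n)%N /\ z i = z0 i &
    forall x, P x -> exists2 i, (i < n)%N & ~ sep (z i) x].
Proof.
move=> PQ hB n0 z0; move: {2}(B - n0)%N (leqnn (B - n0)) => k.
elim: k n0 z0 => [|k IH] n0 z0 hk h0.
- exists n0, z0; split => //; first by move=> i hi; right; exists i.
  move=> x Px; apply: contrapT => hno.
  suff: sep_family Q n0.+1 (fun i => if (i < n0)%N then z0 i else x).
    by move=> /hB; move: hk; rewrite leqn0 subn_eq0 => h1 h2; move: (leq_trans h2 h1); rewrite ltnn.
  split=> [i _|i j /andP[ij]]; first by case: ifP => hi; [exact: h0.1|exact: PQ].
  rewrite ltnS leq_eqVlt => /orP[/eqP E|hj].
    subst j; rewrite ij ltnn; apply: contrapT => hs; apply: hno.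
    by exists i.
  by rewrite hj (ltn_trans ij hj); apply: h0.2; rewrite ij.
- have [[x [Px hx]]|hno] := pselect (exists x, P x /\ forall i, (i < n0)%N -> sep (z0 i) x); last first.
    exists n0, z0; split => //; first by move=> i hi; right; exists i.
    move=> x Px; apply: contrapT => hn; apply: hno; exists x; split => // i hi.
    by apply: contrapT => hs; apply: hn; exists i.
  have h1 : sep_family Q n0.+1 (fun i => if (i < n0)%N then z0 i else x).
    split=> [i _|i j /andP[ij]]; first by case: ifP => hi; [exact: h0.1|exact: PQ].
    rewrite ltnS leq_eqVlt => /orP[/eqP E|hj].
      by subst j; rewrite ij ltnn; exact: hx.
    by rewrite hj (ltn_trans ij hj); apply: h0.2; rewrite ij.
  have hle : (B - n0.+1 <= k)%N by rewrite subnS; case: (B - n0)%N hk.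
  have [n [z [hz hP hext hmax]]] := IH _ _ hle h1.
  exists n, z; split => //.
  + move=> i /hP[Pz|[j hj ->]]; first by left.
    by case: ifP => hj'; [right; exists j|left].
  + move=> i hi; have [? ->] := hext i (ltnW hi); split => //.
    by rewrite hi.
Qed.

(* Vitali selection: the levels are exhausted one after the other, so that an
   element of level [k] is blocked by a selected one of level at most [k]. *)
Lemma greedy_separated (lev : T -> nat) (P Q : T -> Prop) (B : nat) :
  (forall x, P x -> Q x) ->
  (forall n z, sep_family Q n z -> (n <= B)%N) ->
  (exists x : T, True) ->
  forall M, exists n z, sep_family (fun x => P x /\ (lev x < M)%N) n z /\
   (forall x, P x -> (lev x < M)%N ->
      exists i, [/\ (i < n)%N, (lev (z i) <= lev x)%N & ~ sep (z i) x]).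
Proof.
move=> PQ hB [x0 _]; elim=> [|M [n0 [z0 [h0 hm0]]]].
  by exists 0%N, (fun=> x0); split => //; split => // i j /andP[].
have hB' : forall n z, sep_family (fun x => P x /\ (lev x < M.+1)%N) n z -> (n <= B)%N.
  by move=> n z [h1 h2]; apply: (hB n z); split => // i /h1[/PQ].
have h0' : sep_family (fun x => P x /\ (lev x < M.+1)%N) n0 z0.
  by split; [move=> i /h0.1[? /ltnW]|exact: h0.2].
have [n [z [hz hP hext hmax]]] :=
  @extend_separated _ (fun x => P x /\ lev x = M) B
   (fun x (h : P x /\ lev x = M) => conj h.1 (eq_leq (congr1 succn h.2)))
   hB' _ _ h0'.
exists n, z; split => // x Px.
rewrite ltnS leq_eqVlt => /orP[/eqP E|hl].
  have [i hi hs] := hmax x (conj Px E); exists i; split => //.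
  by rewrite E -ltnS; exact: (hz.1 _ hi).2.
have [i [hi hle hs]] := hm0 x Px hl; have [hi' E] := hext i hi.
by exists i; rewrite E.
Qed.

End Separated.

Section Nbd.
Variables (R : realType) (X : Type) (D : X -> X -> R).
Hypothesis hD : is_metric D.

Definition nbd (S : set X) (eta : R) := [set x | exists2 y, S y & D x y < eta].

Lemma dist_ge0 x y : 0 <= D x y. Proof. exact: hD.1. Qed.
Lemma dist_refl x : D x x = 0. Proof. exact: (hD.2.1 x x).2. Qed.
Lemma dist_sym x y : D x y = D y x. Proof. exact: hD.2.2.1. Qed.
Lemma dist_tri y x z : D x z <= D x y + D y z. Proof. exact: hD.2.2.2. Qed.

Lemma dopen_ball x r : dopen D (oball D x r).
Proof.
move=> y; rewrite /oball /= => xy; exists (r - D x y); first by rewrite subr_gt0.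
move=> z /=; have := dist_tri y x z; lra.
Qed.

Lemma dborel_ball x r : dborel D (oball D x r).
Proof. by apply: dborel_open; exact: dopen_ball. Qed.

(* Mass distribution principle in a form which needs no limit measure: a finite
   subfamily of an open cover of [K] already covers some [S n]. *)
Lemma mass_distribution (S : nat -> set X) (eta : nat -> R) (mu : nat -> set X -> R)
    (K : set X) (s theta e : R) :
  0 < s -> 0 < theta -> dcompact D K -> (forall n, 0 < eta n) ->
  nbd (S 0%N) (eta 0%N) `<=` K ->
  (forall n, nbd (S n.+1) (eta n.+1) `<=` nbd (S n) (eta n / 2)) ->
  (forall n, fcontent D (mu n)) ->
  (forall n A, dborel D A -> A `&` S n = set0 -> mu n A = 0) ->
  (forall n, theta <= mu n setT) ->
  (forall n x (r : R), 0 < r -> mu n (oball D x r) <= 2 * r `^ s) ->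
  ((theta / 8)%:E <= hausdorff_content D s e (\bigcap_n nbd (S n) (eta n)))%E.
Proof.
move=> s0 th0 hK heta hSK hSS hmu hsupp hmass hball.
apply: le_ereal_inf_tmp => _ [U [hcov hdiam] <-].
rewrite leNgt; apply/negP => hlt.
pose dd j := diam_pow s (ddiam D (U j)).
have dd0 j : (0 <= dd j)%E.
  by rewrite /dd /diam_pow; case: (ddiam D (U j)) => [r| |] //; rewrite lee_fin powR_ge0.
pose d j := fine (dd j).
have ddE j : dd j = (d j)%:E.
  by rewrite /d /dd; move: (hdiam j); case: (ddiam D (U j)).
(* Slack that turns the cover into an open one. The [ep j] and the [d j] each sum to at most
   theta/8, and the ball bound costs a factor 2, so the open sets carry less than theta/2. *)
pose ep j : R := theta / 8 * (1 / 2) ^+ j.+1.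
have ep0 j : 0 < ep j by rewrite /ep !mulr_gt0 ?exprn_gt0 //; lra.
have sum_ep n : \sum_(j < n) ep j <= theta / 8.
  have : \sum_(j < n) ep j = theta / 8 * (1 - (1 / 2) ^+ n).
    elim: n => [|n IH]; first by rewrite big_ord0 expr0; lra.
    rewrite big_ord_recr /= IH /ep exprS; lra.
  move=> ->; rewrite -[leRHS]mulr1; apply: ler_wpM2l; first lra.
  by rewrite gerBl exprn_ge0 //; lra.
have sum_d n : \sum_(j < n) d j < theta / 8.
  rewrite -lte_fin -sumEFin; apply: le_lt_trans hlt.
  have := @nneseries_lim_ge R dd xpredT 0 n (fun j _ _ => dd0 j).
  rewrite big_mkord; apply: le_trans; rewrite le_eqVlt; apply/orP; left; apply/eqP.
  by apply: eq_bigr => j _; rewrite ddE.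
have hO j : exists V : set X, [/\ dopen D V, U j `<=` V &
    forall n, mu n V <= 2 * (d j + ep j)].
  have d_ge0 : 0 <= d j by rewrite -lee_fin -ddE.
  have [[x Ux]|hE] := pselect (exists x, U j x); last first.
    exists set0; split; first by move=> x.
      by move=> x Ux; case: hE; exists x.
    by move=> n; rewrite (fcontent0 (hmu n)); have := ep0 j; lra.
  (* The radius with r^s = [d j + ep j] exceeds the diameter of [U j], so the ball about any point
     of [U j] contains [U j]. *)
  pose r := (d j + ep j) `^ s^-1.
  have dp : 0 < d j + ep j by have := ep0 j; lra.
  have rs : r `^ s = d j + ep j.
    by rewrite /r -powRrM mulVf ?gt_eqF // powRr1 // ltW.
  have r0 : 0 < r by exact: powR_gt0.
  exists (oball D x r); split; first exact: dopen_ball.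
    move=> y Uy; rewrite /oball /=.
    have hxy : ((D x y)%:E <= ddiam D (U j))%E.
      by apply: ereal_sup_ubound; exists x => //; exists y.
    have : d j = (fine (ddiam D (U j))) `^ s /\ D x y <= fine (ddiam D (U j)).
      by rewrite /d /dd; move: hxy (hdiam j); case: (ddiam D (U j)) => [q| |] //=.
    move=> [dE Dle]; rewrite ltNge; apply/negP => hr.
    have : r `^ s <= (fine (ddiam D (U j))) `^ s.
      apply: ge0_ler_powR; rewrite ?nnegrE; [lra|lra| |].
        exact: le_trans (dist_ge0 x y) Dle.
      exact: le_trans hr Dle.
    by rewrite rs -dE; have := ep0 j; lra.
  by move=> n; rewrite -rs; exact: hball.
have {hO} [V hO] := choice hO.
(* If the first n open sets covered [S n], they would carry the whole mass of [mu n], which is at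
   least theta. *)
have hx n : exists x, S n x /\ forall j, (j < n)%N -> ~ V j x.
  apply: contrapT => hno.
  have hOb j : (j < n)%N -> dborel D (V j).
    by move=> _; apply: dborel_open; have [] := hO j.
  pose W := [set x | exists2 j, (j < n)%N & V j x].
  have hV : dborel D W by exact: dborel_bigcup_lt.
  have hC : mu n (~` W) = 0.
    apply: hsupp; first exact: dborelC.
    apply/seteqP; split => x //= -[nV Sx]; apply: hno; exists x; split => // j hj Oj.
    by apply: nV; exists j.
  have hVm : mu n W <= \sum_(j < n) mu n (V j).
    by apply: (fcontent_cover (hmu n) (P := xpredT)) => // x [j hj Oj]; exists j.
  have hT : mu n setT = mu n W + mu n (~` W).
    by rewrite -(hmu n).2 ?setUv ?setICr //; exact: dborelC.
  have hs : \sum_(j < n) mu n (V j) <= \sum_(j < n) 2 * (d j + ep j).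
    by apply: ler_sum => j _; have [] := hO j.
  have := hmass n; rewrite hT hC; move: hs; rewrite -mulr_sumr big_split /=.
  by have := sum_ep n; have := sum_d n; lra.
have {hx} [x hx] := choice hx.
have hnest n k : nbd (S (n + k)%N) (eta (n + k)%N) `<=` nbd (S n) (eta n).
  elim: k => [|k IH]; first by rewrite addn0.
  rewrite addnS => y /hSS hy; apply: IH.
  by case: hy => z Sz hz; exists z => //; have := heta (n + k)%N; lra.
have hnest2 n k : (n < k)%N -> nbd (S k) (eta k) `<=` nbd (S n) (eta n / 2).
  by move=> nk; rewrite -(subnKC nk) => y /hnest /hSS.
have Snbd n : S n `<=` nbd (S n) (eta n).
  by move=> y Sy; exists y => //; rewrite dist_refl.
have hxK n : K (x n) by apply: hSK; apply: (hnest 0%N n); apply: Snbd; have [] := hx n.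
have [phi [hphi [y Ky hcv]]] := hK x hxK.
have hmono n : (n <= phi n)%N by elim: n => // n IH; exact: leq_ltn_trans (hphi n).
have hnear (g : R) : 0 < g -> exists N, forall n, (N <= n)%N -> D (x (phi n)) y < g.
  move=> g0; have [N _ hN] := (cvgrPdist_lt _ _).1 hcv g g0.
  exists N => n /hN /=; rewrite sub0r normrN ger0_norm //; exact: dist_ge0.
(* The halved radius in the nesting hypothesis leaves room for the limit: far terms lie within
   [eta n / 2] of [S n] and within [eta n / 2] of [y]. *)
have hy : (\bigcap_n nbd (S n) (eta n)) y.
  move=> n _; have [N hN] := hnear (eta n / 2) (divr_gt0 (heta n) (ltr0n _ 2)).
  pose k := maxn N n.+1.
  have := @hnest2 n (phi k) (leq_trans (leq_maxr N n.+1) (hmono k)) (x (phi k))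
    (Snbd _ _ (hx (phi k)).1).
  move=> [z Sz hz]; exists z => //; have := hN k (leq_maxl _ _).
  by have := dist_tri (x (phi k)) y z; rewrite (dist_sym y (x (phi k))); lra.
have [j _ Uj] := hcov y hy.
have [Oop UO _] := hO j.
have [r r0 hr] := Oop y (UO _ Uj).
(* [j.+1] forces [phi k > j], so [x (phi k)] avoids [V j], although it lies in the ball about [y]
   contained in [V j]. *)
have [N hN] := hnear r r0; pose k := maxn N j.+1.
apply: ((hx (phi k)).2 j).
  exact: leq_trans (leq_maxr N j.+1) (hmono k).
by apply: hr; rewrite /oball /= dist_sym; apply: hN; exact: leq_maxl.
Qed.

End Nbd.

(** * Redistribution of mass *)

Lemma exists_pos_le (R : realType) n (e : nat -> R) :
  (forall i, (i < n)%N -> 0 < e i) ->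
  exists2 e0, 0 < e0 & forall i, (i < n)%N -> e0 <= e i.
Proof.
elim: n => [|n IH] h; first by exists 1.
have [|e0 e00 he0] := IH; first by move=> i hi; apply: h; exact: ltnW.
exists (Num.min e0 (e n)); first by rewrite lt_min e00 h.
move=> i; rewrite ltnS leq_eqVlt => /orP[/eqP ->|/he0 hi].
  by rewrite ge_min lexx orbT.
by rewrite ge_min hi.
Qed.

Lemma gt0_powRD (R : realType) (x a b : R) : 0 < x -> x `^ (a + b) = x `^ a * x `^ b.
Proof. by move=> x0; rewrite powRD // (gt_eqF x0) implybT. Qed.

Lemma exists_pos_le4 (R : realType) (a b c d : R) :
  0 < a -> 0 < b -> 0 < c -> 0 < d ->
  exists h : R, [/\ 0 < h, h <= a, h <= b, h <= c & h <= d].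
Proof.
move=> a0 b0 c0 d0; exists (Num.min (Num.min a b) (Num.min c d)).
by rewrite !lt_min !ge_min a0 b0 c0 d0 !lexx !orbT.
Qed.

Section Redistribution.
Variables (R : realType) (X : Type) (D : X -> X -> R) (m : set X -> \bar R).
Hypothesis hD : is_metric D.
Hypothesis mP : borel_prob_measure D m.
Variables (Q cA CA r0 : R).
Hypotheses (cA0 : 0 < cA) (CA0 : 0 < CA) (r00 : 0 < r0).
Hypothesis ball_lower : forall x (r : R), 0 < r -> r <= r0 -> cA * r `^ Q <= mass m (oball D x r).
Hypothesis ball_upper : forall x (r : R), 0 < r -> mass m (oball D x r) <= CA * r `^ Q.

Definition supported (mu : set X -> R) (S : set X) :=
  forall A, dborel D A -> A `&` S = set0 -> mu A = 0.

(* Every ball carries a probability, concentrated well inside [G N], which looks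
   [s]-dimensional at all scales after normalisation by the measure of the ball. *)
Definition redistributable (G : nat -> set X) (s : R) :=
  exists C rs : R, [/\ 0 < C, 0 < rs & forall x0 (r : R) N, 0 < r -> r <= rs ->
    exists (nu : set X -> R) (S : set X) (eta M : R),
      [/\ fcontent D nu, forall A, dborel D A -> nu A <= M * mass m A,
          supported nu S & nu setT = 1] /\
      [/\ 0 < eta, nbd D S eta `<=` oball D x0 r `&` G N &
        forall x (t : R), 0 < t -> nu (oball D x t) <= C * t `^ s / r `^ Q]].

(** A bounded density is carried along because the next step needs cells of size h to have mass of
    order h^Q, which the last clause does not give when s < Q. The bound [M] may change freely from
    one state to the next. *)
Definition frostman_state (s c : R) (mu : set X -> R) (S : set X) (eta : R) :=
  [/\ fcontent D mu, exists M, forall A, dborel D A -> mu A <= M * mass m A,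
      supported mu S, 0 < eta &
      forall x (r : R), 0 < r -> mu (oball D x r) <= c * r `^ s].

Lemma ball_borel x r : dborel D (oball D x r).
Proof. exact: dborel_ball. Qed.

(** Balls of radius h/2 about h-separated points are disjoint, and Ahlfors regularity bounds the
    mass of each from below. *)
Lemma separated_packing (h : R) n (z : nat -> X) (P : pred nat) A : 0 < h -> h <= r0 ->
  (forall i j, (i < j < n)%N -> h <= D (z i) (z j)) -> dborel D A ->
  (forall i, (i < n)%N -> P i -> oball D (z i) (h / 2) `<=` A) ->
  \sum_(i < n | P i) cA * (h / 2) `^ Q <= mass m A.
Proof.
move=> h0 hr0 hsep hA hsub.
apply: (@le_trans _ _ (\sum_(i < n | P i) mass m (oball D (z i) (h / 2)))).
  by apply: ler_sum => i _; apply: ball_lower; lra.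
apply: (fcontent_packing (mass_content mP) (F := fun i => oball D (z i) (h / 2))) => //.
  by move=> i hi Pi; split; [exact: ball_borel|exact: hsub].
move=> i j ij _ _; apply/seteqP; split => x //= -[]; rewrite /oball /= => hi hj.
have := hsep i j ij; have := dist_tri hD x (z i) (z j).
by rewrite (dist_sym hD x); lra.
Qed.

Lemma space_inhabited : exists x : X, True.
Proof.
apply: contrapT => hno; have : (setT : set X) = set0.
  by apply/seteqP; split => x // _; apply: hno; exists x.
move=> hE; have := massT mP; rewrite hE (fcontent0 (mass_content mP)).
by move/eqP; rewrite eq_sym oner_eq0.
Qed.

Lemma exists_net (h : R) : 0 < h -> h <= r0 ->
  exists n (z : nat -> X), (forall i j, (i < j < n)%N -> h <= D (z i) (z j)) /\
    (forall x, exists2 i, (i < n)%N & D (z i) x < h).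
Proof.
move=> h0 hr0; have [x0 _] := space_inhabited.
have v0 : 0 < cA * (h / 2) `^ Q by rewrite mulr_gt0 // powR_gt0 //; lra.
pose B := Num.bound (1 / (cA * (h / 2) `^ Q)).
have hB n z : sep_family (fun x y => is_true (h <= D x y)) (fun=> True) n z -> (n <= B)%N.
  move=> [_ hs]; apply: ltnW; rewrite -(ltr_nat R).
  have := @archi_boundP R (1 / (cA * (h / 2) `^ Q)) (divr_ge0 ler01 (ltW v0)).
  apply: le_lt_trans; rewrite ler_pdivlMr //.
  have := separated_packing (P := xpredT) h0 hr0 hs (@dborelT _ _ D) (fun _ _ _ _ _ => I).
  by rewrite (massT mP) sumr_const card_ord mulr_natl.
have [|n [z [hz _ _ hmax]]] := @extend_separated _ _ _ (fun=> True) B (fun _ _ => I) hB 0%N (fun=> x0).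
  by split => // i j /andP[].
exists n, z; split; first exact: hz.2.
move=> x; have [i hi hs] := hmax x I; exists i => //.
by rewrite ltNge; apply/negP.
Qed.

(** Space is cut into cells of size h and the mass of each cell is spread anew. Balls much larger
    than h see only the cell masses, up to an enlargement of the radius by 2h. Smaller balls meet
    boundedly many cells, each giving at most a constant times r^s'; this constant is fixed before
    h, so the gap between s and s' absorbs it once h is small. *)
Lemma redistribution_step (G : nat -> set X) (s s' c c' : R) mu S eta N :
  0 < s -> s < s' -> redistributable G s' -> 1 <= c -> c < c' ->
  frostman_state s c mu S eta ->
  exists mu' S' eta', [/\ frostman_state s c' mu' S' eta', mu' setT = mu setT &
    nbd D S' eta' `<=` nbd D S (eta / 2) `&` G N].
Proof.
move=> s0 ss' [C [rs [C0 rs0 hG]]] c1 cc' [hmu [M1 hM1] hsupp eta0 hball].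
pose M := Num.max M1 0.
have M0 : 0 <= M by rewrite /M le_max lexx orbT.
have hM A : dborel D A -> mu A <= M * mass m A.
  move=> hA; apply: le_trans (hM1 _ hA) _; apply: ler_wpM2r.
    exact: fcontent_ge0 (mass_content mP) _ hA.
  by rewrite /M le_max lexx.
(* Enlarging a radius by the factor [q] replaces the constant [c] by [c']. *)
pose q := (c' / c) `^ s^-1.
have cc : 0 < c by lra.
have qs : c * q `^ s = c'.
  rewrite /q -powRrM mulVf ?gt_eqF // powRr1; last by apply: divr_ge0; lra.
  by field; rewrite gt_eqF.
have q1 : 1 < q.
  rewrite ltNge; apply/negP => hq.
  have : q `^ s <= 1 `^ s.
    by apply: ge0_ler_powR; rewrite ?nnegrE ?powR_ge0 //; lra.
  by rewrite powR1 => h; have := ler_wpM2l (ltW cc) h; rewrite qs; lra.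
(* Chosen so that r >= L h implies r + 2h <= q r. *)
pose L := 2 / (q - 1).
have L0 : 0 < L by rewrite /L divr_gt0 //; lra.
have Lq : L * (q - 1) = 2 by rewrite /L divfK // gt_eqF //; lra.
(* Bound for the number of net balls met by a ball of radius below L h: balls of radius h/2 are
   packed into one of radius (L + 2) h. *)
pose P0 := CA * (2 * (L + 2)) `^ Q / cA.
have P00 : 0 <= P0 by rewrite /P0 !mulr_ge0 ?powR_ge0 ?invr_ge0 ?ltW.
pose K0 := P0 * (M * CA * C).
have MC0 : 0 <= M * CA * C.
  by apply: mulr_ge0; [apply: mulr_ge0 => //|]; exact: ltW.
have K00 : 0 <= K0 by exact: mulr_ge0.
(* Below the scale [g], the product of [K0] and r^(s' - s) is less than 1. *)
pose g := (1 / (K0 + 1)) `^ (s' - s)^-1.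
have g0 : 0 < g by apply: powR_gt0; rewrite divr_gt0 //; lra.
have gs : g `^ (s' - s) = 1 / (K0 + 1).
  rewrite /g -powRrM mulVf ?powRr1 //; first by apply: divr_ge0; lra.
  by rewrite gt_eqF //; lra.
have P0E : P0 = CA * (2 * (L + 2)) `^ Q / cA by [].
have K0E : K0 = P0 * (M * CA * C) by [].
clearbody K0 P0 g L q M.
have [h [h0 hrs heta hr0 hg]] : exists h : R, [/\ 0 < h, h <= rs, 2 * h <= eta / 2, h <= r0 & L * h <= g].
  have [//||//||h [h0 h1 h2 h3 hL]] := @exists_pos_le4 R rs (eta / 4) r0 (g / L).
  - by rewrite divr_gt0.
  - exact: divr_gt0.
  exists h; split => //; first lra.
  by move: hL; rewrite ler_pdivlMr // mulrC.
have [n [z [hz hcov]]] := exists_net h0 hr0.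
(* A point belongs to the cell of the first net ball that contains it. *)
pose E i := oball D (z i) h `\` [set x | exists2 j, (j < i)%N & oball D (z j) h x].
have hE i : dborel D (E i).
  apply: dborelD; first exact: ball_borel.
  by apply: dborel_bigcup_lt => j _; exact: ball_borel.
have Edisj i j : (i < j)%N -> E i `&` E j = set0.
  by move=> ij; apply/seteqP; split => x //= -[[Ei _] [_ []]]; exists i.
have Ecov x : exists2 i, (i < n)%N & E i x.
  have hex : exists i, `[< D (z i) x < h >] by have [i _ ?] := hcov x; exists i; apply/asboolP.
  have [i hi] := hcov x.
  have := ex_minnP hex => -[k /asboolP hk kmin] hix.
  exists k; first by apply: leq_ltn_trans hi; apply: kmin; apply/asboolP.
  split => // -[j hj hjx]; have := kmin j; rewrite leqNgt hj.
  by move=> /(_ _)/negP; apply => //; apply/asboolP.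
(* Cells missing [S] have no mass. The ball of a cell that meets [S] stays within 2h <= eta/2 of
   [S], whence the nesting. *)
pose P i := `[< exists x, E i x /\ S x >].
have hnu i := hG (z i) h N h0 hrs.
have {hnu}[nu hnu] := choice hnu; have {hnu}[Z hnu] := choice hnu.
have {hnu}[et hnu] := choice hnu; have {hnu}[Mi hnu] := choice hnu.
have [e e0 he] := @exists_pos_le R n et (fun i _ => let: conj _ (And3 h _ _) := hnu i in h).
pose mu' A := \sum_(i < n | P i) mu (E i) * nu i A.
have nuc i : fcontent D (nu i) by have [[]] := hnu i.
have muE0 i : 0 <= mu (E i) by exact: (fcontent_ge0 hmu (hE i)).
have hmu' : fcontent D mu'.
  by apply: (fcontent_sum (w := fun i => mu (E i))) => i _ _; [exact: muE0|exact: nuc].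
have nule i A : dborel D A -> nu i A <= 1.
  move=> hA; have [[_ _ _ <-] _] := hnu i.
  by apply: (fcontent_le (nuc i)) => //; exact: dborelT.
have Zsub i : Z i `<=` oball D (z i) h `&` G N.
  have [_ [ei hs _]] := hnu i; apply: subset_trans hs => x Zx.
  by exists x => //; rewrite dist_refl.
pose P' x r i := P i && `[< exists y, oball D (z i) h y /\ oball D x r y >].
have mu'le x r : mu' (oball D x r) <= \sum_(i < n | P' x r i) mu (E i) * nu i (oball D x r).
  rewrite /mu' [leRHS]big_mkcond [leLHS]big_mkcond /=; apply: ler_sum => i _.
  rewrite /P'; case: (P i) => //=; case: asboolP => // hno.
  have [[_ _ hs _] _] := hnu i; rewrite hs ?mulr0 //; first exact: ball_borel.
  apply/seteqP; split => y //= -[By Zy]; apply: hno; exists y; split => //.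
  by have [] := Zsub _ _ Zy.
exists mu', [set x | exists i, [/\ (i < n)%N, P i & Z i x]], e; split; last first.
- move=> x [y [i [hi Pi Zy]] xy].
  have [_ [_ hs _]] := hnu i.
  have [hx Gx] := hs x (ex_intro2 _ _ y Zy (lt_le_trans xy (he i hi))).
  split => //; move/asboolP: Pi => [w [[Ew _] Sw]]; exists w => //.
  move: hx Ew; rewrite /oball /= => hx hw.
  have := dist_tri hD (z i) x w; rewrite (dist_sym hD x (z i)); lra.
- rewrite /mu'; under eq_bigr => i _.
    have [[_ _ _ ->] _] := hnu i; rewrite mulr1; over.
  apply/eqP; rewrite eq_le; apply/andP; split.
    by apply: (fcontent_packing hmu) => //; [exact: dborelT|move=> i j /andP[ij _] _ _; exact: Edisj].
  pose V := [set x | exists2 i, (i < n)%N & (if P i then E i else set0) x].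
  have hV : dborel D V.
    by apply: dborel_bigcup_lt => i _; case: ifP => _ //; exact: dborel0.
  rewrite (fcontentID hmu (@dborelT _ _ D) hV) !setTI.
  rewrite (_ : mu (setT `\` V) = 0) ?addr0.
    apply: (fcontent_cover hmu) => // x [i hi]; case: ifP => // Pi Ei.
    by exists i.
  apply: hsupp; first exact: dborelD (@dborelT _ _ D) hV.
  apply/seteqP; split => x //= -[[_ nV] Sx]; apply: nV.
  have [i hi Ei] := Ecov x; exists i => //.
  by rewrite ifT //; apply/asboolP; exists x.
- split => //.
  + exists (\sum_(i < n | P i) mu (E i) * Mi i) => A hA.
    rewrite mulr_suml; apply: ler_sum => i _; rewrite -mulrA ler_wpM2l //.
    by have [[_ hMi _ _] _] := hnu i; exact: hMi.
  + move=> A hA hAS; rewrite /mu' big1 // => i Pi.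
    have [[_ _ hs _] _] := hnu i; rewrite hs ?mulr0 //.
    apply/seteqP; split => y //= -[Ay Zy].
    suff: (A `&` [set x | exists i, [/\ (i < n)%N, P i & Z i x]]) y by rewrite hAS.
    by split => //=; exists i.
  + move=> x r rr0; apply: le_trans (mu'le x r) _.
    have [hr|hr] := leP (L * h) r.
      apply: (@le_trans _ _ (\sum_(i < n | P' x r i) mu (E i))).
        apply: ler_sum => i _; rewrite -[leRHS]mulr1 ler_wpM2l //.
        by apply: nule; exact: ball_borel.
      apply: (@le_trans _ _ (mu (oball D x (r + 2 * h)))).
        apply: (fcontent_packing hmu); first exact: ball_borel.
          move=> i hi /andP[_ /asboolP[y [yz yx]]]; split => //.
          move=> w [wz _]; move: yz yx wz; rewrite /oball /= => h1 h2 h3.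
          have := dist_tri hD y x w; have := dist_tri hD (z i) y w.
          by rewrite (dist_sym hD y (z i)); lra.
        by move=> i j /andP[ij _] _ _; exact: Edisj.
      apply: le_trans (hball x _ _) _; first lra.
      rewrite -qs -mulrA; apply: ler_wpM2l; first lra.
      rewrite -powRM; [|lra|exact: ltW].
      apply: ge0_ler_powR; rewrite ?nnegrE; [lra|lra|by rewrite mulr_ge0 //; lra|].
      have : 2 * h <= (q - 1) * r.
        rewrite -Lq; have -> : L * (q - 1) * h = (q - 1) * (L * h) by ring.
        by apply: ler_wpM2l => //; lra.
      lra.
    apply: (@le_trans _ _ (\sum_(i < n | P' x r i) M * CA * C * r `^ s')).
      apply: ler_sum => i _.
      have h1 : mu (E i) <= M * (CA * h `^ Q).
        apply: le_trans (hM _ (hE i)) _; apply: ler_wpM2l => //.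
        apply: le_trans (ball_upper (z i) h0).
        apply: (fcontent_le (mass_content mP)) => //; first exact: ball_borel.
        by move=> y [].
      have h2 : nu i (oball D x r) <= C * r `^ s' / h `^ Q.
        by have [_ [_ _ h2]] := hnu i; exact: h2.
      have hQ : 0 < h `^ Q by exact: powR_gt0.
      (* The factor h^Q from the bounded density cancels the normalisation of [nu i], so the bound
         per cell does not depend on h. *)
      have -> : M * CA * C * r `^ s' = M * (CA * h `^ Q) * (C * r `^ s' / h `^ Q).
        by field; rewrite gt_eqF.
      apply: ler_pM => //.
      by apply: (fcontent_ge0 (nuc i)); exact: ball_borel.
    have hcount : \sum_(i < n | P' x r i) (1 : R) <= P0.
      have := @separated_packing h n z (P' x r) (oball D x ((L + 2) * h)) h0 hr0 hz (ball_borel _ _).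
      move=> /(_ _)/le_trans-/(_ _ _ (ball_upper _ _)).
      have hLh : 0 < (L + 2) * h by apply: mulr_gt0 => //; exact: addr_gt0.
      have E1 : ((L + 2) * h) `^ Q = (2 * (L + 2)) `^ Q * (h / 2) `^ Q.
        by rewrite -powRM ?divr_ge0 ?mulr_ge0 ?addr_ge0 ?ltW //; congr (_ `^ _); field.
      have hQ : 0 < (h / 2) `^ Q by rewrite powR_gt0 ?divr_gt0.
      move=> /(_ _ hLh); rewrite E1 => hh.
      rewrite P0E ler_pdivlMr // -(ler_pM2r hQ).
      have -> : (\sum_(i < n | P' x r i) 1) * cA * (h / 2) `^ Q = \sum_(i < n | P' x r i) cA * (h / 2) `^ Q.
        by rewrite -mulrA mulr_suml; apply: eq_bigr => i _; rewrite mul1r.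
      apply: le_trans (hh _) _; last by rewrite mulrA.
      move=> i hi /andP[_ /asboolP[y [yz yx]]] w wz.
      move: yz yx wz; rewrite /oball /= => k1 k2 k3.
      have := dist_tri hD y x w; have := dist_tri hD (z i) y w.
      by rewrite (dist_sym hD y (z i)); lra.
    have -> : \sum_(i < n | P' x r i) (M * CA * C * r `^ s') =
              (\sum_(i < n | P' x r i) 1) * (M * CA * C * r `^ s').
      by rewrite mulr_suml; apply: eq_bigr => i _; rewrite mul1r.
    apply: (@le_trans _ _ (K0 * r `^ s')).
      rewrite K0E -[leRHS]mulrA; apply: ler_wpM2r => //.
      by apply: mulr_ge0 => //; exact: powR_ge0.
    have -> : s' = (s' - s) + s by ring.
    rewrite gt0_powRD //.
    rewrite mulrA; apply: ler_wpM2r; first exact: powR_ge0.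
    apply: (@le_trans _ _ 1); last lra.
    apply: (@le_trans _ _ (K0 * (1 / (K0 + 1)))).
      apply: ler_wpM2l => //; rewrite -gs.
      by apply: ge0_ler_powR; rewrite ?nnegrE; lra.
    by rewrite mulrA mulr1 ler_pdivrMr; lra.
Qed.

Lemma hausdorff_contentS (s e : R) (A B : set X) : A `<=` B ->
  (hausdorff_content D s e A <= hausdorff_content D s e B)%E.
Proof.
move=> AB; apply: ereal_inf_le_tmp => _ [U [BU hU] <-].
by exists U => //; split => //; exact: subset_trans AB BU.
Qed.

Lemma initial_frostman_state s : 0 < s -> s <= Q -> dlocally_compact D ->
  exists mu S eta K, [/\ frostman_state s 1 mu S eta, 0 < mu setT,
    dcompact D K & nbd D S eta `<=` K].
Proof.
move=> s0 sQ hloc; have [x0 _] := space_inhabited.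
have [K cK [r r_gt0 rK]] := hloc x0.
pose S := oball D x0 (r / 2).
(* [th * CA <= 1] serves radii t <= 1, where t^Q <= t^s; [th <= 1] serves t > 1, where the total
   mass suffices. *)
pose th := Num.min 1 (1 / CA).
have th0 : 0 < th by rewrite /th lt_min ltr01 divr_gt0.
have th1 : th <= 1 by rewrite /th ge_min lexx.
have thC : th * CA <= 1 by rewrite -ler_pdivlMr // /th ge_min lexx orbT.
have hS : dborel D S by exact: ball_borel.
have mc := mass_content mP.
clearbody th; exists (fun A => th * mass m (A `&` S)), S, (r / 2), K; split => //.
- split.
  + split=> [A hA|A B hA hB AB].
      by apply: mulr_ge0; [exact: ltW|exact: (fcontent_ge0 mc (dborelI hA hS))].
    by rewrite -mulrDr (fcontent_restrict mc hS).2.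
  + exists th => A hA; apply: ler_wpM2l; first exact: ltW.
    by apply: (fcontent_le mc) => //; exact: dborelI.
  + by move=> A hA ->; rewrite (fcontent0 mc) mulr0.
  + by rewrite divr_gt0.
  + move=> x t t0; rewrite mul1r.
    have hB : dborel D (oball D x t `&` S) by apply: dborelI => //; exact: ball_borel.
    have [t1|t1] := leP t 1.
      apply: (@le_trans _ _ (t `^ Q)); last by apply: ger_powR => //; rewrite t0.
      apply: (@le_trans _ _ (th * (CA * t `^ Q))).
        apply: ler_wpM2l; first exact: ltW.
        apply: le_trans (ball_upper x t0).
        by apply: (fcontent_le mc) => //; exact: ball_borel.
      by rewrite mulrA ler_piMl // powR_ge0.
    apply: (@le_trans _ _ 1).
      apply: mulr_ile1 => //; first exact: ltW.
        exact: (fcontent_ge0 mc hB).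
      exact: (mass_le1 mP).
    rewrite -(powRr0 t); apply: ler_powR; exact: ltW.
- apply: mulr_gt0 => //; rewrite setTI.
  have hr : 0 < Num.min (r / 2) r0 by rewrite lt_min divr_gt0.
  apply: (@lt_le_trans _ _ (cA * (Num.min (r / 2) r0) `^ Q)).
    by apply: mulr_gt0 => //; exact: powR_gt0.
  apply: (le_trans (ball_lower x0 hr _)); first by rewrite ge_min lexx orbT.
  apply: (fcontent_le mc) => //; first exact: ball_borel.
  by move=> y; rewrite /oball /= => h; apply: lt_le_trans h _; rewrite ge_min lexx.
- move=> y [z Sz yz]; apply: rK; move: Sz; rewrite /S /oball /= => Sz.
  have := dist_tri hD z x0 y; rewrite (dist_sym hD z y).
  by clearbody S; lra.
Qed.

Theorem redistributable_hausdorff_measure (G : nat -> set X) (s s' : R) :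
  0 < s -> s < s' -> s <= Q -> dlocally_compact D -> redistributable G s' ->
  (0 < hausdorff_measure D s (\bigcap_n G n))%E.
Proof.
move=> s0 ss' sQ hloc hG.
have [mu0 [S0 [eta0 [K [h0 mu00 cK SK]]]]] := initial_frostman_state s0 sQ hloc.
(* Constants increasing from 1 and staying below 2: each of the infinitely many steps may lose a
   little. *)
pose c n : R := 2 - (1 / 2) ^+ n.
have chalf n : 0 < (1 / 2 : R) ^+ n /\ (1 / 2 : R) ^+ n <= 1.
  by split; [rewrite exprn_gt0|rewrite exprn_ile1]; lra.
have c1 n : 1 <= c n by rewrite /c; have := chalf n; lra.
have cc n : c n < c n.+1 by rewrite /c exprS; have := chalf n; lra.
pose St := ((set X -> R) * set X * R)%type.
pose good n (p : St) := frostman_state s (c n) p.1.1 p.1.2 p.2.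
(* The step is made total so that [choice] applies; on a bad state its value is arbitrary. *)
have hstep (np : nat * St) : exists q : St, good np.1 np.2 ->
    [/\ good np.1.+1 q, q.1.1 setT = np.2.1.1 setT &
     nbd D q.1.2 q.2 `<=` nbd D np.2.1.2 (np.2.2 / 2) `&` G np.1].
  case: np => n [[mu S] eta].
  have [hg|hg] := pselect (good n (mu, S, eta)); last by exists (mu, S, eta) => /hg.
  have [mu' [S' [eta' h]]] := redistribution_step n s0 ss' hG (c1 n) (cc n) hg.
  by exists (mu', S', eta').
have {hstep} [f hf] := choice hstep.
pose st := fix F n : St := if n is k.+1 then f (k, F k) else (mu0, S0, eta0).
have hgood n : good n (st n).
  elim: n => [|n IH]; first by rewrite /good /c expr0 /= (_ : 2 - 1 = 1) //; lra.
  by have [] := hf (n, st n) IH.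
have hT n : (st n).1.1 setT = mu0 setT.
  elim: n => // n IH; have [_ h _] := hf (n, st n) (hgood n).
  by rewrite /= h.
have hsub n : nbd D (st n.+1).1.2 (st n.+1).2 `<=`
    nbd D (st n).1.2 ((st n).2 / 2) `&` G n.
  by have [] := hf (n, st n) (hgood n).
have key := @mass_distribution R X D hD (fun n => (st n).1.2) (fun n => (st n).2)
  (fun n => (st n).1.1) K s (mu0 setT) 1 s0 mu00 cK.
apply: (@lt_le_trans _ _ (mu0 setT / 8)%:E); first by rewrite lte_fin divr_gt0.
apply: (@le_trans _ _ (hausdorff_content D s 1 (\bigcap_n G n))); last first.
  by apply: ereal_sup_ubound; exists 1 => //=; exact: ltr01.
apply: le_trans (hausdorff_contentS _ _ (A := \bigcap_n nbd D (st n).1.2 (st n).2) _).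
  apply: key.
  - by move=> n; have [] := hgood n.
  - exact: SK.
  - by move=> n x /hsub [].
  - by move=> n; have [] := hgood n.
  - by move=> n; have [] := hgood n.
  - by move=> n; rewrite hT.
  - move=> n x r r_gt0; have [_ _ _ _ h] := hgood n.
    apply: le_trans (h x r r_gt0) _; apply: ler_wpM2r; first exact: powR_ge0.
    by rewrite /c gerBl; have [/ltW] := chalf n.
by move=> x hx n _; have /hsub[] := hx n.+1 I.
Qed.

End Redistribution.

(** * The exponent as a piecewise affine function *)

Section Exponents.
Variables (R : realType) (d : nat) (delta a t : 'I_d -> R) (kappa : R).
Hypotheses (d0 : (0 < d)%N) (a0 : forall i, 0 < a i) (t0 : forall i, 0 < t i).

(** Exponent of u = 2^-k in the share of a piece caught by a ball of radius u^A, weighted by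
    max(u^A, u^a_i)^delta_i. The cases compare the radius with the side u^a_i and the thickness
    u^(a_i + t_i). The formulas agree where they meet, so the function is continuous in A. *)
Definition coord_exp (i : 'I_d) (A : R) : R :=
  if A <= a i then delta i * A
  else if a i + t i <= A then delta i * A - (1 - kappa) * (t i * delta i)
  else kappa * (delta i * A) + (1 - kappa) * (a i * delta i).

Definition total_exp (A : R) := \sum_(i < d) coord_exp i A.

Lemma coord_exp_low i A : A <= a i -> coord_exp i A = delta i * A.
Proof. by rewrite /coord_exp => ->. Qed.

Lemma coord_exp_mid i A : a i <= A -> A <= a i + t i ->
  coord_exp i A = kappa * (delta i * A) + (1 - kappa) * (a i * delta i).
Proof.
move=> h1 h2; rewrite /coord_exp; case: leP => h3.
  have -> : A = a i by apply/eqP; rewrite eq_le h3 h1.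
  ring.
case: leP => // h4.
have -> : A = a i + t i by apply/eqP; rewrite eq_le h2 h4.
ring.
Qed.

Lemma coord_exp_high i A : a i + t i <= A ->
  coord_exp i A = delta i * A - (1 - kappa) * (t i * delta i).
Proof.
move=> h; rewrite /coord_exp; case: leP => h3; last by rewrite h.
by have := t0 i; lra.
Qed.

(** The index sets [K1], [K2], [K3] are the three branches of [coord_exp]. *)
Lemma total_exp_dim_value A : 0 < A ->
  total_exp A = A * dim_value delta a t kappa A.
Proof.
move=> A0; rewrite /dim_value /=.
have E (P : pred 'I_d) (F : 'I_d -> R) :
  \sum_(k < d | P k) F k = \sum_(k < d) (if P k then F k else 0) by exact: big_mkcond.
rewrite (E (fun k => A <= a k)) !(E (fun k => (a k + t k <= A) && ~~ (A <= a k))).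
rewrite !(E (fun k => ~~ (A <= a k) && ~~ ((a k + t k <= A) && ~~ (A <= a k)))).
rewrite -sumrB !mulr_sumr mulr_suml -!big_split /= mulr_sumr.
apply: eq_bigr => i _; rewrite /coord_exp.
have hA : A != 0 by rewrite gt_eqF.
by case: (A <= a i); case: (a i + t i <= A) => /=; field.
Qed.

(** The last two hypotheses say that neither breakpoint of coordinate i lies strictly between L and
    U. Written without division, the identity can be summed over i. *)
Lemma coord_exp_affine i L U A : L <= A -> A <= U ->
  (a i <= L \/ U <= a i) -> (a i + t i <= L \/ U <= a i + t i) ->
  (U - L) * coord_exp i A = (U - A) * coord_exp i L + (A - L) * coord_exp i U.
Proof.
move=> LA AU [h1|h1] h2; last first.
  by rewrite !coord_exp_low; [ring|lra..].
case: h2 => h2; first by rewrite !coord_exp_high; [ring|lra..].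
by rewrite !coord_exp_mid; [ring|lra..].
Qed.

(** Indexed by a finite type, so that extremal breakpoints come from [arg_minP] and [arg_maxP]. *)
Definition breakpoint (b : 'I_d * bool) := a b.1 + (if b.2 then t b.1 else 0).

Lemma breakpoint_gt0 b : 0 < breakpoint b.
Proof. by rewrite /breakpoint; have := a0 b.1; have := t0 b.1; case: b.2; lra. Qed.

(** At A = min a_i every coordinate is in its first regime, where the exponent is A times the sum of
    the delta_i. *)
Lemma exp_le_total_delta s : (forall b, s * breakpoint b <= total_exp (breakpoint b)) ->
  s <= \sum_(i < d) delta i.
Proof.
move=> hs; case: (@Order.TotalTheory.arg_minP _ R _ (Ordinal d0) xpredT a isT) => i _ hmin.
have := hs (i, false); rewrite /breakpoint /= addr0 /total_exp.
rewrite (eq_bigr (fun k => delta k * a i)); last by move=> k _; rewrite coord_exp_low ?hmin.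
by rewrite -mulr_suml ler_pM2r.
Qed.

(* [total_exp] is affine between consecutive breakpoints, so that its lower
   bound by a linear function need only be checked at the breakpoints. *)
Lemma total_exp_ge s A : 0 < A ->
  (forall b, s * breakpoint b <= total_exp (breakpoint b)) -> s * A <= total_exp A.
Proof.
move=> A0 hs; have sD := exp_le_total_delta hs.
have [[bl hbl]|hno] := pselect (exists b, breakpoint b <= A); last first.
  rewrite /total_exp (eq_bigr (fun i => delta i * A)).
    by rewrite -mulr_suml ler_pM2r.
  move=> i _; rewrite coord_exp_low // leNgt; apply/negP => h.
  by apply: hno; exists (i, false); rewrite /breakpoint /= addr0 ltW.
case: (@Order.TotalTheory.arg_maxP _ R _ bl (fun b => breakpoint b <= A) breakpoint hbl) => {hbl}bl hbl hmax.
set L := breakpoint bl in hbl hmax *.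
have [[bu hbu]|hno] := pselect (exists b, A <= breakpoint b); last first.
  have hb b : breakpoint b <= A.
    by rewrite leNgt; apply/negP => h; apply: hno; exists b; exact: ltW.
  have hi i : a i + t i <= L by exact: (hmax (i, true) (hb _)).
  have hi' i : a i + t i <= A by exact: (hb (i, true)).
  (* Beyond the last breakpoint the slope is the sum of the delta_i, which is at least s. *)
  have -> : total_exp A = total_exp L + (\sum_(i < d) delta i) * (A - L).
    rewrite /total_exp mulr_suml -big_split /=; apply: eq_bigr => i _.
    by rewrite !coord_exp_high //; ring.
  have h1 := hs bl; rewrite -/L in h1.
  have h2 : s * (A - L) <= (\sum_(i < d) delta i) * (A - L).
    by apply: ler_wpM2r => //; rewrite subr_ge0.
  by apply: le_trans (lerD h1 h2); rewrite -mulrDr addrC subrK.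
case: (@Order.TotalTheory.arg_minP _ R _ bu (fun b => A <= breakpoint b) breakpoint hbu) => {hbu}bu hbu hmin.
set U := breakpoint bu in hbu hmin *.
have hb b : breakpoint b <= L \/ U <= breakpoint b.
  by have [h|h] := leP (breakpoint b) A; [left; exact: hmax|right; apply: hmin; exact: ltW].
have [LU|UL] := ltP L U; last first.
  have -> : A = L by apply/eqP; rewrite eq_le hbl (le_trans hbu UL).
  exact: hs.
have E : (U - L) * total_exp A = (U - A) * total_exp L + (A - L) * total_exp U.
  rewrite /total_exp !mulr_sumr -big_split /=; apply: eq_bigr => i _.
  apply: coord_exp_affine => //; last exact: (hb (i, true)).
  by have := hb (i, false); rewrite /breakpoint /= addr0.
rewrite -(ler_pM2l (_ : 0 < U - L)) ?subr_gt0 // E.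
have h1 : (U - A) * (s * L) <= (U - A) * total_exp L.
  by apply: ler_wpM2l; [rewrite subr_ge0|exact: hs].
have h2 : (A - L) * (s * U) <= (A - L) * total_exp U.
  by apply: ler_wpM2l; [rewrite subr_ge0|exact: hs].
apply: le_trans (lerD h1 h2); rewrite le_eqVlt; apply/orP; left; apply/eqP; ring.
Qed.

(** The gain does not depend on A; it becomes the decay exponent per dyadic level. *)
Lemma total_exp_slack s s' amin A : (forall b, s' * breakpoint b <= total_exp (breakpoint b)) ->
  0 < amin -> amin <= A -> s < s' -> s * A + (s' - s) * amin <= total_exp A.
Proof.
move=> hs am0 amA ss'; apply: le_trans (total_exp_ge (lt_le_trans am0 amA) hs).
have -> : s' * A = s * A + (s' - s) * A by ring.
by rewrite lerD2l; apply: ler_wpM2l => //; lra.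
Qed.

(** The infimum runs over finitely many values, all above s, so the least of them can serve as
    s'. *)
Lemma dim_number_breakpoints s :
  (s%:E < dim_number delta a t kappa)%E -> exists2 s', s < s' &
  forall b, s' * breakpoint b <= total_exp (breakpoint b).
Proof.
move=> hs; pose v b := dim_value delta a t kappa (breakpoint b).
have hv b : s < v b.
  rewrite -lte_fin; apply: (lt_le_trans hs); apply: ereal_inf_lbound.
  exists (breakpoint b) => //=; exists b.1; rewrite /breakpoint.
  by case: b.2; [right|left; rewrite addr0].
pose b0 := (Ordinal d0, false).
case: (@Order.TotalTheory.arg_minP _ R _ b0 xpredT v isT) => b _ hmin.
exists (v b) => // b'; rewrite total_exp_dim_value ?breakpoint_gt0 // mulrC.
by apply: ler_wpM2l; [exact/ltW/breakpoint_gt0|exact: hmin].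
Qed.

End Exponents.

(** * Products of metric spaces *)

Lemma exists_pos_le_ord (R : realType) d (e : 'I_d -> R) :
  (forall i, 0 < e i) -> exists2 e0, 0 < e0 & forall i, e0 <= e i.
Proof.
move=> h; pose f k := if insub k is Some i then e i else 1.
have [|e0 e00 he] := @exists_pos_le R d f.
  by move=> k _; rewrite /f; case: insub.
by exists e0 => // i; have := he i (ltn_ord i); rewrite /f valK.
Qed.

Lemma cvg0_nonnegP (R : realType) (f : nat -> R) : (forall n, 0 <= f n) ->
  f @ \oo --> (0 : R) <->
  forall e : R, 0 < e -> exists N, forall n, (N <= n)%N -> f n < e.
Proof.
move=> f0; split=> [h e e0|h].
  have [N _ hN] := (cvgrPdist_lt _ _).1 h e e0.
  by exists N => n /hN /=; rewrite sub0r normrN ger0_norm.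
apply/cvgrPdist_lt => e e0; have [N hN] := h e e0.
by exists N => // n /= /hN; rewrite sub0r normrN ger0_norm.
Qed.

Lemma nondecreasing_subseq (phi : nat -> nat) :
  (forall n, (phi n < phi n.+1)%N) -> forall n, (n <= phi n)%N.
Proof. by move=> h; elim=> // n IH; exact: leq_ltn_trans (h n). Qed.

Section ProductSpace.
Variables (R : realType) (d : nat) (T : 'I_d -> Type)
  (dist : forall i, T i -> T i -> R).
Hypothesis hdist : forall i, is_metric (@dist i).

Let X := forall i, T i.
Let D : X -> X -> R := prod_dist dist.

Lemma prod_dist_lt (x y : X) r : 0 < r ->
  D x y < r <-> forall i, dist (x i) (y i) < r.
Proof.
move=> r0; rewrite /D /prod_dist; split=> [h i|h].
  by apply: le_lt_trans h; apply: le_bigmax_cond.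
by apply/bigmax_ltP; split.
Qed.

Lemma prod_dist_le (x y : X) r : 0 <= r ->
  (forall i, dist (x i) (y i) <= r) -> D x y <= r.
Proof. by move=> r0 h; apply/bigmax_leP; split. Qed.

Lemma prod_dist_ge (x y : X) i : dist (x i) (y i) <= D x y.
Proof. exact: le_bigmax_cond. Qed.

Lemma prod_dist_ge0 (x y : X) : 0 <= D x y.
Proof. exact: bigmax_ge_id. Qed.

Lemma prod_metric : is_metric D.
Proof.
split; [exact: prod_dist_ge0|split; [|split]].
- move=> x y; split=> [h|->].
    apply: functional_extensionality_dep => i; apply/(hdist i).2.1/eqP.
    by rewrite eq_le (hdist i).1 andbT -h prod_dist_ge.
  apply/eqP; rewrite eq_le prod_dist_ge0 andbT; apply: prod_dist_le => // i.
  by rewrite dist_refl.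
- by move=> x y; apply: eq_bigr => i _; rewrite (dist_sym (hdist i)).
- move=> x y z; apply: prod_dist_le.
    by apply: addr_ge0; exact: prod_dist_ge0.
  move=> i; apply: le_trans (dist_tri (hdist i) (y i) _ _) _.
  by apply: lerD; exact: prod_dist_ge.
Qed.

Lemma oball_drect (x : X) r : 0 < r ->
  oball D x r = drect (fun i => oball (@dist i) (x i) r).
Proof. by move=> r0; apply/seteqP; split => y /(prod_dist_lt _ _ r0). Qed.

Lemma dopen_drect (A : forall i, set (T i)) :
  (forall i, dopen (@dist i) (A i)) -> dopen D (drect A).
Proof.
move=> hA x Ax.
have h i : exists r : R, 0 < r /\ oball (@dist i) (x i) r `<=` A i.
  by have [r r0 hr] := hA i _ (Ax i); exists r.
have [r hr] := choice h.
have [e e0 he] := exists_pos_le_ord (fun i => (hr i).1).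
exists e => // y; rewrite oball_drect // => hy i.
by apply: (hr i).2; apply: lt_le_trans (hy i) (he i).
Qed.

(** Subsequences are extracted one coordinate after another, by induction on the number [k] of
    coordinates already convergent. *)
Lemma dcompact_drect (K : forall i, set (T i)) :
  (forall i, dcompact (@dist i) (K i)) -> dcompact D (drect K).
Proof.
move=> hK u hu.
have dge0 i (x : nat -> T i) y n : 0 <= dist (x n) y by exact: (hdist i).1.
have key k : (k <= d)%N -> exists phi : nat -> nat,
    (forall n, (phi n < phi n.+1)%N) /\ forall i : 'I_d, (i < k)%N ->
    exists2 y, K i y & forall e : R, 0 < e -> exists N, forall n, (N <= n)%N ->
      dist (u (phi n) i) y < e.
  elim: k => [|k IH] hk; first by exists id.
  have [phi [hphi hconv]] := IH (ltnW hk).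
  pose ik := Ordinal hk.
  have [psi [hpsi [y Ky hy]]] := hK ik (fun n => u (phi n) ik) (fun n => hu _ ik).
  exists (phi \o psi); split.
    have phimono : {homo phi : m n / (m < n)%N >-> (m < n)%N}.
      by apply: homo_ltn => //; exact: ltn_trans.
    by move=> n; exact: phimono.
  move=> i; rewrite ltnS leq_eqVlt => /orP[/eqP E|hi].
    have -> : i = ik by exact: val_inj.
    exists y => // e e0.
    have [N hN] := (cvg0_nonnegP (fun n => dge0 ik (fun n => u (phi (psi n)) ik) y n)).1 hy e e0.
    by exists N.
  have [z Kz hz] := hconv i hi; exists z => // e e0.
  have [N hN] := hz e e0; exists N => n hn; apply: hN.
  exact: leq_trans (nondecreasing_subseq hpsi n).
have [phi [hphi hconv]] := key d (leqnn d).
have h i : exists y, K i y /\ forall e : R, 0 < e -> exists N, forall n, (N <= n)%N ->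
      dist (u (phi n) i) y < e.
  by have [y ? ?] := hconv i (ltn_ord i); exists y.
pose y i := projT1 (cid (h i)).
have hy i : K i (y i) /\ forall e : R, 0 < e -> exists N, forall n, (N <= n)%N ->
      dist (u (phi n) i) (y i) < e by exact: (projT2 (cid (h i))).
exists phi; split => //; exists y; first by move=> i; exact: (hy i).1.
apply/cvg0_nonnegP; first by move=> n; exact: prod_dist_ge0.
move=> e e0.
have hN i : exists N, forall n, (N <= n)%N -> dist (u (phi n) i) (y i) < e.
  exact: (hy i).2.
have {hN}[N hN] := choice hN.
exists (\max_i N i) => n hn; apply/prod_dist_lt => // i.
by apply: hN; apply: leq_trans hn; exact: leq_bigmax.
Qed.

Lemma prod_locally_compact : (forall i, dlocally_compact (@dist i)) ->
  dlocally_compact D.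
Proof.
move=> h x.
have h' i : exists Kr : set (T i) * R, dcompact (@dist i) Kr.1 /\
   (0 < Kr.2 /\ oball (@dist i) (x i) Kr.2 `<=` Kr.1).
  by have [K cK [r r0 hr]] := h i (x i); exists (K, r).
pose Kr i := projT1 (cid (h' i)).
have hKr i : dcompact (@dist i) (Kr i).1 /\
   (0 < (Kr i).2 /\ oball (@dist i) (x i) (Kr i).2 `<=` (Kr i).1) by exact: (projT2 (cid (h' i))).
exists (drect (fun i => (Kr i).1)).
  by apply: dcompact_drect => i; exact: (hKr i).1.
have [e e0 he] := exists_pos_le_ord (fun i => (hKr i).2.1).
exists e => // y; rewrite oball_drect // => hy i.
by apply: (hKr i).2.2; apply: lt_le_trans (hy i) (he i).
Qed.

Variables (mi : forall i, set (T i) -> \bar R) (delta : 'I_d -> R)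
  (m : set X -> \bar R).
Arguments mi : clear implicits.
Hypothesis miP : forall i, borel_prob_measure (@dist i) (mi i).
Hypothesis mP : is_product_measure dist mi m.

Lemma mass_drect (A : forall i, set (T i)) :
  (forall i, dborel (@dist i) (A i)) ->
  mass m (drect A) = \prod_(i < d) mass (mi i) (A i).
Proof.
move=> hA; rewrite /mass mP.2 //.
under eq_bigr => i _ do rewrite (measure_fin (miP i) (hA i)).
by rewrite -(big_morph _ (@EFinM R) (erefl 1%:E)).
Qed.

Lemma ahlfors_uniform : (forall i, 0 < delta i) ->
  (forall i, ahlfors_regular (@dist i) (mi i) (delta i)) ->
  exists (cl Cu : 'I_d -> R) (r0 : R), [/\ forall i, 0 < cl i, forall i, 0 < Cu i, 0 < r0,
    forall i x r, 0 < r -> r <= r0 -> cl i * r `^ delta i <= mass (mi i) (oball (@dist i) x r) &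
    forall i x r, 0 < r -> mass (mi i) (oball (@dist i) x r) <= Cu i * r `^ delta i].
Proof.
move=> delta0 hreg.
have h i : exists q : R * R * R, [/\ 0 < q.1.1, 0 < q.1.2, 0 < q.2 &
    forall x r, 0 < r <= q.2 ->
      ((q.1.1 * r `^ delta i)%:E <= mi i (oball (@dist i) x r) <= (q.1.2 * r `^ delta i)%:E)%E].
  by have [c [C [r0 h]]] := hreg i; exists (c, C, r0).
have {h}[q hq] := choice h.
have hr i : 0 < (q i).2 by have [] := hq i.
have [r0 r00 hr0] := exists_pos_le_ord hr.
(* The second term of the maximum extends the upper bound to all radii: above [r0] a mass is still
   at most 1. *)
exists (fun i => (q i).1.1), (fun i => Num.max (q i).1.2 (1 / r0 `^ delta i)), r0.
have hb i x r : dborel (@dist i) (oball (@dist i) x r) by exact: dborel_ball.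
split => //.
- by move=> i; have [] := hq i.
- by move=> i; have [_ h _ _] := hq i; rewrite lt_max h.
- move=> i x r rp rr0; have [_ _ _ h] := hq i.
  have /andP[] := h x r (introT andP (conj rp (le_trans rr0 (hr0 i)))).
  by rewrite (measure_fin (miP i)) // lee_fin.
- move=> i x r rp; have [_ _ _ h] := hq i.
  have [rr0|rr0] := leP r r0.
    have /andP[_] := h x r (introT andP (conj rp (le_trans rr0 (hr0 i)))).
    rewrite (measure_fin (miP i)) // lee_fin => /le_trans; apply.
    by apply: ler_wpM2r; [exact: powR_ge0|rewrite le_max lexx].
  apply: le_trans (mass_le1 (miP i) (hb i x r)) _.
  have hp : 0 < r0 `^ delta i by exact: powR_gt0.
  apply: (@le_trans _ _ (1 / r0 `^ delta i * r `^ delta i)).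
    rewrite mulrAC mul1r ler_pdivlMr // mul1r.
    by apply: ge0_ler_powR; rewrite ?nnegrE ltW.
  by apply: ler_wpM2r; [exact: powR_ge0|rewrite le_max lexx orbT].
Qed.

End ProductSpace.

(** * The estimate in one coordinate *)

Lemma nbhdsetP (R : realType) (T : Type) (dist : T -> T -> R) (E : set T) e y :
  nbhdset dist E e y <-> exists2 z, E z & dist y z < e.
Proof.
rewrite /nbhdset /dist_set /=; split=> [|[z Ez yz]].
  by move/ereal_inf_lt => [_ [z Ez <-]]; rewrite lte_fin; exists z.
by apply: (@le_lt_trans _ _ (dist y z)%:E); [apply: ereal_inf_lbound; exists z|rewrite lte_fin].
Qed.

Lemma nbhdsetS (R : realType) (T : Type) (dist : T -> T -> R) (E : set T) e e' :
  e <= e' -> nbhdset dist E e `<=` nbhdset dist E e'.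
Proof.
by move=> ee' y /nbhdsetP[z Ez yz]; apply/nbhdsetP; exists z => //; exact: lt_le_trans ee'.
Qed.

Lemma dopen_nbhdset (R : realType) (T : Type) (dist : T -> T -> R) (E : set T) e :
  is_metric dist -> dopen dist (nbhdset dist E e).
Proof.
move=> hd y /nbhdsetP[z Ez yz]; exists (e - dist y z); first by rewrite subr_gt0.
move=> w; rewrite /oball /= => yw; apply/nbhdsetP; exists z => //.
by have := dist_tri hd y w z; rewrite (dist_sym hd w y); lra.
Qed.

Definition dyadic (R : realType) (k : nat) : R := (1 / 2) ^+ k.
Arguments dyadic {R} k.

(** * Dyadic scales *)

Section Dyadic.
Variable R : realType.
Implicit Types (k : nat) (e : R).

Lemma dyadic_gt0 k : 0 < dyadic k :> R. Proof. by rewrite exprn_gt0 //; lra. Qed.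
Lemma dyadic_le1 k : dyadic k <= 1 :> R. Proof. by rewrite exprn_ile1 //; lra. Qed.
Lemma dyadic_lt1 k : (0 < k)%N -> dyadic k < 1 :> R.
Proof. by case: k => // k _; rewrite exprn_ilt1 //; lra. Qed.
Lemma dyadic_le k l : (k <= l)%N -> dyadic l <= dyadic k :> R.
Proof. by move=> kl; apply: ler_wiXn2l => //; lra. Qed.

Lemma dyadic_small e : 0 < e -> exists N, forall k, (N <= k)%N -> dyadic k < e.
Proof.
move=> e0.
have h : (fun n => dyadic n : R) @ \oo --> (0 : R).
  by apply: cvg_expr; rewrite ger0_norm; lra.
have /(cvg0_nonnegP (fun n => ltW (dyadic_gt0 n))) := h.
by apply.
Qed.

End Dyadic.

Section Coordinate.
Variables (R : realType) (d : nat) (T : 'I_d -> Type)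
  (dist : forall i, T i -> T i -> R).
Variables (mi : forall i, set (T i) -> \bar R) (delta a t : 'I_d -> R) (kappa : R)
  (J : Type) (Rset : forall i, J -> set (T i)).
Arguments mi : clear implicits.
Arguments Rset : clear implicits.
Hypothesis hdist : forall i, is_metric (@dist i).
Hypothesis miP : forall i, borel_prob_measure (@dist i) (mi i).
Hypotheses (a0 : forall i, 0 < a i) (t0 : forall i, 0 < t i).
Variables (c2 c3 Cu : 'I_d -> R) (r1 : R).
Hypotheses (c20 : forall i, 0 < c2 i) (c30 : forall i, 0 < c3 i)
  (Cu0 : forall i, 0 < Cu i).
Hypothesis coord_upper : forall i x (r : R), 0 < r ->
  mass (mi i) (oball (@dist i) x r) <= Cu i * r `^ delta i.
Hypothesis scaling : forall i alpha x (eps r : R), Rset i alpha x -> 0 < eps -> eps < r -> r <= r1 ->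
  c2 i * r `^ (delta i * kappa) * eps `^ (delta i * (1 - kappa)) <=
  mass (mi i) (oball (@dist i) x r `&` nbhdset (@dist i) (Rset i alpha) eps) <=
  c3 i * r `^ (delta i * kappa) * eps `^ (delta i * (1 - kappa)).

Definition brad (k : nat) (i : 'I_d) : R := dyadic k `^ a i.
(** [dyadic k / 2] bounds from below the value that was rounded up to [dyadic k]. The last halving
    lets a neighbourhood of the piece, of width [thickness], stay inside the target
    neighbourhood. *)
Definition thickness (k : nat) (i : 'I_d) : R := (dyadic k / 2) `^ (a i + t i) / 2.
Definition piece i (alpha : J) (z : T i) (k : nat) : set (T i) :=
  oball (@dist i) z (brad k i / 2) `&` nbhdset (@dist i) (Rset i alpha) (thickness k i).

Lemma brad_gt0 k i : 0 < brad k i. Proof. exact/powR_gt0/dyadic_gt0. Qed.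

Lemma thickness_gt0 k i : 0 < thickness k i.
Proof. by rewrite divr_gt0 // powR_gt0 // divr_gt0 // dyadic_gt0. Qed.

Lemma thicknessE k i : thickness k i =
  dyadic k `^ (a i + t i) * ((1 / 2) `^ (a i + t i) / 2).
Proof.
rewrite /thickness mulrA; congr (_ / _).
have -> : dyadic k / 2 = dyadic k * (1 / 2) :> R by rewrite mul1r.
by rewrite powRM ?divr_ge0 //; exact/ltW/dyadic_gt0.
Qed.

Lemma half_powR_le1 (p : R) : 0 <= p -> (1 / 2 : R) `^ p <= 1.
Proof. by move=> p0; rewrite -[leRHS](powRr0 (1 / 2)); apply: ger_powR => //; lra. Qed.

Lemma thickness_lt k i : thickness k i < dyadic k `^ (a i + t i).
Proof.
have h := powR_gt0 (a i + t i) (dyadic_gt0 R k).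
rewrite thicknessE gtr_pMr //.
by have := half_powR_le1 (ltW (addr_gt0 (a0 i) (t0 i))); lra.
Qed.

Lemma thickness_lt_brad k i : thickness k i < brad k i / 2.
Proof.
rewrite /thickness ltr_pM2r ?invr_gt0 //.
have u0 := dyadic_gt0 R k; have u1 := dyadic_le1 R k.
apply: (@lt_le_trans _ _ (dyadic k `^ (a i + t i))).
  by apply: gt0_ltr_powR; rewrite ?nnegrE ?addr_gt0 //; lra.
by apply: ger_powR; [rewrite u0|have := t0 i; lra].
Qed.

Lemma piece_open i alpha z k : dopen (@dist i) (@piece i alpha z k).
Proof. by apply: dopenI; [exact: dopen_ball|exact: dopen_nbhdset]. Qed.

Lemma piece_borel i alpha z k : dborel (@dist i) (@piece i alpha z k).
Proof. by apply: dborel_open; exact: piece_open. Qed.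

(** These constants record the halvings: [half_const] that of the radius in [piece], [thick_const]
    the two in [thickness]. *)
Definition half_const i : R := (1 / 2) `^ (delta i * kappa).
Definition thick_const i : R := ((1 / 2) `^ (a i + t i) / 2) `^ (delta i * (1 - kappa)).

Lemma half_const_gt0 i : 0 < half_const i. Proof. by apply: powR_gt0; lra. Qed.
Lemma thick_const_gt0 i : 0 < thick_const i.
Proof. by apply: powR_gt0; rewrite divr_gt0 // powR_gt0 //; lra. Qed.

Lemma thickness_powR k i : thickness k i `^ (delta i * (1 - kappa)) =
  dyadic k `^ ((a i + t i) * (delta i * (1 - kappa))) * thick_const i.
Proof.
rewrite thicknessE powRM ?divr_ge0 ?powR_ge0 //.
by rewrite -powRrM.
Qed.

Lemma piece_lower i alpha z k : Rset i alpha z -> brad k i <= r1 ->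
  c2 i * (dyadic k `^ (a i * (delta i * kappa)) * half_const i) *
    thickness k i `^ (delta i * (1 - kappa)) <= mass (mi i) (@piece i alpha z k).
Proof.
move=> Rz hr; have r0 := brad_gt0 k i.
have hr2 : brad k i / 2 <= r1 by lra.
have /andP[h _] := scaling Rz (thickness_gt0 k i) (thickness_lt_brad k i) hr2.
have -> : dyadic k `^ (a i * (delta i * kappa)) * half_const i = (brad k i / 2) `^ (delta i * kappa).
  have -> : brad k i / 2 = brad k i * (1 / 2) by rewrite mul1r.
  by rewrite powRM ?(ltW r0) ?divr_ge0 // /brad -powRrM.
exact: h.
Qed.

Lemma piece_gt0 i alpha z k : Rset i alpha z -> brad k i <= r1 ->
  0 < mass (mi i) (@piece i alpha z k).
Proof.
move=> Rz hr; apply: lt_le_trans (piece_lower Rz hr).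
rewrite !mulr_gt0 ?powR_gt0 ?half_const_gt0 ?thickness_gt0 ?dyadic_gt0 //.
Qed.

(** One summand per regime: the trivial bound, the upper against the lower scaling bound, and the
    Ahlfors upper bound against the lower scaling bound. *)
Definition piece_const i : R := 1 + c3 i * 3 `^ (delta i * kappa) / (c2 i * half_const i)
  + Cu i / (c2 i * half_const i * thick_const i).

Lemma piece_const_ge i : [/\ 1 <= piece_const i,
  c3 i * 3 `^ (delta i * kappa) / (c2 i * half_const i) <= piece_const i &
  Cu i / (c2 i * half_const i * thick_const i) <= piece_const i].
Proof.
rewrite /piece_const.
have h1 : 0 < c3 i * 3 `^ (delta i * kappa) / (c2 i * half_const i).
  by rewrite divr_gt0 // mulr_gt0 ?powR_gt0 ?half_const_gt0.
have h2 : 0 < Cu i / (c2 i * half_const i * thick_const i).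
  by rewrite divr_gt0 // !mulr_gt0 ?thick_const_gt0 ?half_const_gt0.
by split; lra.
Qed.

(** The intersection is bounded by the whole piece, by the scaling property or by the Ahlfors bound,
    according to the regime, and compared with [piece_lower]. The power of the maximum is kept on
    the left because it cancels later against a packing volume. *)
Lemma piece_ratio i alpha z k x A : Rset i alpha z -> brad k i <= r1 / 3 -> 0 < A ->
  mass (mi i) (oball (@dist i) x (dyadic k `^ A) `&` @piece i alpha z k)
    * Num.max (dyadic k `^ A) (brad k i) `^ delta i <=
  piece_const i * dyadic k `^ (coord_exp delta a t kappa i A) *
    mass (mi i) (@piece i alpha z k).
Proof.
move=> Rz hr A0; have [C1 Cmid Chigh] := piece_const_ge i.
have u0 := dyadic_gt0 R k; have u1 := dyadic_le1 R k.
have u01 : 0 < (dyadic k : R) <= 1 by rewrite u0.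
have rp := brad_gt0 k i.
have hr1 : brad k i <= r1 by lra.
have plow := piece_lower Rz hr1.
set u : R := dyadic k in u0 u1 u01 plow *.
set p := mass (mi i) (@piece i alpha z k) in plow *.
have mc := mass_content (miP i).
have hB r : dborel (@dist i) (oball (@dist i) x r) by exact: dborel_ball.
have hP := @piece_borel i alpha z k.
have p0 : 0 <= p by exact: (fcontent_ge0 mc hP).
have hBP r := dborelI (hB r) hP.
have c2i := c20 i; have hhc := half_const_gt0 i; have htc := thick_const_gt0 i.
set rho := u `^ A.
have rho0 : 0 < rho by exact: powR_gt0.
have [Aa|aA] := leP A (a i).
  rewrite coord_exp_low //.
  have -> : Num.max rho (brad k i) = rho by apply/max_idPl; exact: ger_powR.
  have -> : rho `^ delta i = u `^ (delta i * A) by rewrite /rho -powRrM mulrC.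
  rewrite mulrC -mulrA mulrCA; apply: ler_wpM2l; first exact: powR_ge0.
  apply: (@le_trans _ _ p); last by rewrite ler_peMl.
  by apply: (fcontent_le mc) => //; exact: subIsetr.
have -> : Num.max rho (brad k i) = brad k i by apply/max_idPr; apply: ger_powR => //; exact: ltW.
have -> : brad k i `^ delta i = u `^ (a i * delta i) by rewrite /brad -powRrM.
have rho_rad : rho <= brad k i by apply: ger_powR => //; exact: ltW.
have [Aat|atA] := leP A (a i + t i).
  rewrite coord_exp_mid //; last exact: ltW.
  have [[y [yB [yP1 yP2]]]|hno] :=
      pselect (exists y, oball (@dist i) x rho y /\ @piece i alpha z k y); last first.
    rewrite (_ : _ `&` _ = set0) ?(fcontent0 mc) ?mul0r.
      by rewrite !mulr_ge0 ?powR_ge0 //; lra.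
    by apply/seteqP; split => // y [? ?]; apply: hno; exists y.
  (* The scaling property needs a centre in the resonant set: [w] is within [thickness] < rho of
     [y], so the ball about [x] lies in the ball of radius 3 rho about [w]. Hence the requirement
     that [brad] be at most r1/3. *)
  have /nbhdsetP[w Rw yw] := yP2.
  have hth : thickness k i < rho.
    apply: lt_le_trans (thickness_lt k i) _; exact: ger_powR.
  have th3 : thickness k i < 3 * rho by lra.
  have r3 : 3 * rho <= r1 by lra.
  have /andP[_ hup] := scaling Rw (thickness_gt0 k i) th3 r3.
  have hle : mass (mi i) (oball (@dist i) x rho `&` @piece i alpha z k) <=
      c3 i * (3 * rho) `^ (delta i * kappa) * thickness k i `^ (delta i * (1 - kappa)).
    apply: le_trans hup; apply: (fcontent_le mc) => //.
      apply: dborelI; first exact: dborel_ball.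
      by apply: dborel_open; exact: dopen_nbhdset.
    move=> v [vB [_ vR]]; split => //; move: vB yB; rewrite /oball /= => vB yB.
    have := dist_tri (hdist i) y w v; have := dist_tri (hdist i) x y v.
    by rewrite (dist_sym (hdist i) w y) (dist_sym (hdist i) y x); lra.
  apply: le_trans (ler_wpM2r (powR_ge0 _ _) hle) _.
  set th := thickness k i `^ _ in plow *.
  have th0 : 0 < th by apply: powR_gt0; exact: thickness_gt0.
  apply: le_trans (ler_wpM2l _ plow); last by rewrite mulr_ge0 ?powR_ge0 //; lra.
  rewrite powRM; [|lra|exact: ltW].
  have -> : rho `^ (delta i * kappa) = u `^ (A * (delta i * kappa)) by rewrite /rho -powRrM.
  have E : u `^ (kappa * (delta i * A) + (1 - kappa) * (a i * delta i)) *
      u `^ (a i * (delta i * kappa)) = u `^ (A * (delta i * kappa)) * u `^ (a i * delta i).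
    by rewrite -!gt0_powRD //; congr (_ `^ _); ring.
  have -> : piece_const i * u `^ (kappa * (delta i * A) + (1 - kappa) * (a i * delta i)) *
     (c2 i * (u `^ (a i * (delta i * kappa)) * half_const i) * th) =
     (piece_const i * (c2 i * half_const i)) * th *
     (u `^ (kappa * (delta i * A) + (1 - kappa) * (a i * delta i)) * u `^ (a i * (delta i * kappa))).
    by ring.
  rewrite E.
  have -> : c3 i * (3 `^ (delta i * kappa) * u `^ (A * (delta i * kappa))) * th * u `^ (a i * delta i) =
    (c3 i * 3 `^ (delta i * kappa)) * th * (u `^ (A * (delta i * kappa)) * u `^ (a i * delta i)).
    by ring.
  apply: ler_wpM2r; first by rewrite mulr_ge0 ?powR_ge0.
  apply: ler_wpM2r; first exact: ltW.
  by move: Cmid; rewrite ler_pdivrMr // mulr_gt0.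
rewrite coord_exp_high //; last exact: ltW.
have hle : mass (mi i) (oball (@dist i) x rho `&` @piece i alpha z k) <= Cu i * u `^ (A * delta i).
  rewrite powRrM; apply: le_trans (coord_upper x rho0).
  by apply: (fcontent_le mc) => //; exact: subIsetl.
apply: le_trans (ler_wpM2r (powR_ge0 _ _) hle) _.
apply: le_trans (ler_wpM2l _ plow); last by rewrite mulr_ge0 ?powR_ge0 //; lra.
rewrite thickness_powR -/u.
set e1 := (a i + t i) * _.
have E : u `^ (delta i * A - (1 - kappa) * (t i * delta i)) * u `^ (a i * (delta i * kappa)) *
    u `^ e1 = u `^ (A * delta i) * u `^ (a i * delta i).
  by rewrite -!gt0_powRD //; congr (_ `^ _); rewrite /e1; ring.
have -> : piece_const i * u `^ (delta i * A - (1 - kappa) * (t i * delta i)) *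
  (c2 i * (u `^ (a i * (delta i * kappa)) * half_const i) * (u `^ e1 * thick_const i)) =
  (piece_const i * (c2 i * half_const i * thick_const i)) *
  (u `^ (delta i * A - (1 - kappa) * (t i * delta i)) * u `^ (a i * (delta i * kappa)) * u `^ e1).
  by ring.
rewrite E -[leLHS]mulrA; apply: ler_wpM2r; first by rewrite mulr_ge0 ?powR_ge0.
by move: Chigh; rewrite ler_pdivrMr // !mulr_gt0.
Qed.

End Coordinate.

(** * Disjoint rectangles *)

Lemma prodr_powR (R : realType) d (x : R) (f : 'I_d -> R) : 0 < x ->
  \prod_(i < d) x `^ f i = x `^ (\sum_(i < d) f i).
Proof.
by move=> x0; rewrite (big_morph (fun p => x `^ p) (fun p q => gt0_powRD p q x0) (powRr0 x)).
Qed.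

Lemma prodr_gt0_ord (R : realType) d (f : 'I_d -> R) :
  (forall i, 0 < f i) -> 0 < \prod_(i < d) f i.
Proof. by move=> h; apply: prodr_gt0 => i _. Qed.

Section Boxes.
Variables (R : realType) (d : nat) (T : 'I_d -> Type)
  (dist : forall i, T i -> T i -> R).
Let X := forall i, T i.
Let D : X -> X -> R := prod_dist dist.
Variables (mi : forall i, set (T i) -> \bar R) (delta a : 'I_d -> R)
  (m : set X -> \bar R).
Arguments mi : clear implicits.
Hypothesis hdist : forall i, is_metric (@dist i).
Hypothesis miP : forall i, borel_prob_measure (@dist i) (mi i).
Hypothesis mP : is_product_measure dist mi m.
Variables (cl Cu : 'I_d -> R) (r0 : R).
Hypotheses (cl0 : forall i, 0 < cl i) (Cu0 : forall i, 0 < Cu i).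
Hypothesis coord_lower : forall i x (r : R), 0 < r -> r <= r0 ->
  cl i * r `^ delta i <= mass (mi i) (oball (@dist i) x r).
Hypothesis coord_upper : forall i x (r : R), 0 < r ->
  mass (mi i) (oball (@dist i) x r) <= Cu i * r `^ delta i.

Definition box (x : X) (w : 'I_d -> R) : set X :=
  drect (fun i => oball (@dist i) (x i) (w i)).

Lemma box_open x w : dopen D (box x w).
Proof. by apply: dopen_drect => // i; exact: dopen_ball. Qed.

Lemma box_borel x w : dborel D (box x w).
Proof. by apply: dborel_open; exact: box_open. Qed.

Lemma mass_box x w : mass m (box x w) = \prod_(i < d) mass (mi i) (oball (@dist i) (x i) (w i)).
Proof. by apply: mass_drect => // i; exact: dborel_ball. Qed.

Lemma box_lower x w : (forall i, 0 < w i) -> (forall i, w i <= r0) ->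
  (\prod_(i < d) cl i) * (\prod_(i < d) w i `^ delta i) <= mass m (box x w).
Proof.
move=> w0 wr; rewrite mass_box -big_split /=; apply: ler_prod => i _.
by rewrite coord_lower // mulr_ge0 ?powR_ge0 // ltW.
Qed.

Lemma box_upper x w : (forall i, 0 < w i) ->
  mass m (box x w) <= (\prod_(i < d) Cu i) * (\prod_(i < d) w i `^ delta i).
Proof.
move=> w0; rewrite mass_box -big_split /=; apply: ler_prod => i _.
rewrite coord_upper // andbT; apply: (fcontent_ge0 (mass_content (miP i))).
exact: dborel_ball.
Qed.

Lemma prod_ball_lower x r : 0 < r -> r <= r0 ->
  (\prod_(i < d) cl i) * r `^ (\sum_(i < d) delta i) <= mass m (oball D x r).
Proof.
move=> rp rr0; rewrite oball_drect // -prodr_powR //.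
exact: (@box_lower x (fun=> r)).
Qed.

Lemma prod_ball_upper x r : 0 < r ->
  mass m (oball D x r) <= (\prod_(i < d) Cu i) * r `^ (\sum_(i < d) delta i).
Proof.
move=> rp; rewrite oball_drect // -prodr_powR //.
exact: (@box_upper x (fun=> r)).
Qed.

Variable J : Type.
Let elt := (nat * J * X)%type.

Definition elt_box (e : elt) : set X := box e.2 (brad a e.1.1).

(** Separation along one axis makes the boxes disjoint; if it fails, the centres are closer than the
    sum of the radii along every axis, which is what a Vitali covering needs. *)
Definition elt_sep (e e' : elt) : Prop :=
  exists i, brad a e.1.1 i + brad a e'.1.1 i <= dist (e.2 i) (e'.2 i).

Definition vol (k : nat) : R := \prod_(i < d) brad a k i `^ delta i.

Lemma vol_gt0 k : 0 < vol k.
Proof. by apply: prodr_gt0_ord => i; apply: powR_gt0; exact: brad_gt0. Qed.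

Lemma elt_sep_disjoint e e' : elt_sep e e' -> elt_box e `&` elt_box e' = set0.
Proof.
move=> [i hi]; apply/seteqP; split => x //= -[/(_ i) h1 /(_ i) h2].
move: h1 h2; rewrite /oball /= => h1 h2.
have := dist_tri (hdist i) (x i) (e.2 i) (e'.2 i).
by rewrite (dist_sym (hdist i) (x i)); lra.
Qed.

Lemma elt_packing n (z : nat -> elt) (P : pred nat) (A : set X) :
  (forall i j, (i < j < n)%N -> elt_sep (z i) (z j)) -> dborel D A ->
  (forall j, (j < n)%N -> P j ->
     (forall i, brad a (z j).1.1 i <= r0) /\ elt_box (z j) `<=` A) ->
  (\prod_(i < d) cl i) * (\sum_(j < n | P j) vol (z j).1.1) <= mass m A.
Proof.
move=> hsep hA hz; rewrite mulr_sumr.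
apply: (@le_trans _ _ (\sum_(j < n | P j) mass m (elt_box (z j)))).
  apply: ler_sum => j Pj; have [hr _] := hz j (ltn_ord j) Pj.
  by apply: box_lower => // i; exact: brad_gt0.
apply: (fcontent_packing (mass_content mP.1) (F := fun j => elt_box (z j))) => //.
  by move=> j hj Pj; have [_ ?] := hz j hj Pj; split => //; exact: box_borel.
by move=> i j ij _ _; apply: elt_sep_disjoint; exact: hsep.
Qed.

Hypothesis (a0 : forall i, 0 < a i).

Lemma brad_small e : 0 < e -> exists N, forall k, (N <= k)%N -> forall i, brad a k i <= e.
Proof.
move=> e0.
have he i : 0 < e `^ (a i)^-1 by exact: powR_gt0.
have [e1 e10 he1] := exists_pos_le_ord he.
have [N hN] := dyadic_small e10.
exists N => k hk i; have -> : e = (e `^ (a i)^-1) `^ a i.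
  by rewrite -powRrM mulVf ?gt_eqF // powRr1 // ltW.
apply: ge0_ler_powR; rewrite ?nnegrE; [exact/ltW|exact/ltW/dyadic_gt0|exact: powR_ge0|].
exact: le_trans (ltW (hN k hk)) (he1 i).
Qed.

Lemma brad_le k l i : (k <= l)%N -> brad a l i <= brad a k i.
Proof.
by move=> kl; apply: ge0_ler_powR; rewrite ?nnegrE ?dyadic_le // ltW ?dyadic_gt0.
Qed.

Lemma vol_le k l : (forall i, 0 < delta i) -> (k <= l)%N -> vol l <= vol k.
Proof.
move=> delta0 kl; apply: ler_prod => i _; rewrite powR_ge0 /=.
by apply: ge0_ler_powR; rewrite ?nnegrE ?brad_le //; apply: ltW => //; exact: brad_gt0.
Qed.

End Boxes.
Arguments elt_sep {R d T} dist a {J} e e'.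
Arguments elt_box {R d T} dist a {J} e.

(** * Vitali selection of rectangles inside a ball *)

Section Selection.
Variables (R : realType) (d : nat) (T : 'I_d -> Type)
  (dist : forall i, T i -> T i -> R).
Let X := forall i, T i.
Let D : X -> X -> R := prod_dist dist.
Variables (mi : forall i, set (T i) -> \bar R) (delta a : 'I_d -> R)
  (m : set X -> \bar R) (J : Type) (Rset : forall i, J -> set (T i)) (lev : J -> nat -> Prop).
Arguments mi : clear implicits.
Arguments Rset : clear implicits.
Hypothesis hdist : forall i, is_metric (@dist i).
Hypothesis miP : forall i, borel_prob_measure (@dist i) (mi i).
Hypothesis mP : is_product_measure dist mi m.
Variables (cl Cu : 'I_d -> R) (r0 : R).
Hypotheses (cl0 : forall i, 0 < cl i) (Cu0 : forall i, 0 < Cu i).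
Hypothesis coord_lower : forall i x (r : R), 0 < r -> r <= r0 ->
  cl i * r `^ delta i <= mass (mi i) (oball (@dist i) x r).
Hypothesis coord_upper : forall i x (r : R), 0 < r ->
  mass (mi i) (oball (@dist i) x r) <= Cu i * r `^ delta i.
Hypotheses (delta0 : forall i, 0 < delta i) (a0 : forall i, 0 < a i).

Definition level_set (k : nat) : set X :=
  [set x | exists2 alpha, lev alpha k &
    forall i, nbhdset (@dist i) (Rset i alpha) (brad a k i) (x i)].

Hypothesis full : forall N, mass m [set x | exists2 k, (N <= k)%N & level_set k x] = 1.

Lemma level_set_open k : dopen D (level_set k).
Proof.
have -> : level_set k = \bigcup_(alpha in [set alpha | lev alpha k])
   drect (fun i => nbhdset (@dist i) (Rset i alpha) (brad a k i)).
  by apply/seteqP; split => x [al h1 h2]; exists al.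
apply: dopen_bigcup => al _; apply: dopen_drect => // i.
exact: dopen_nbhdset.
Qed.

Let elt := (nat * J * X)%type.

Definition admissible N (x0 : X) (r : R) (e : elt) : Prop :=
  [/\ (N <= e.1.1)%N, lev e.1.2 e.1.1, forall i, Rset i e.1.2 (e.2 i) &
    exists2 x, oball D x0 r x & forall i, dist (x i) (e.2 i) < brad a e.1.1 i].

(** The numerator is half the lower bound for the mass of a ball of radius r/4, divided by r^Q; the
    denominator bounds the mass of a box with tripled sides relative to [vol]. *)
Definition sel_const : R := (\prod_(i < d) cl i) * (1 / 4) `^ (\sum_(i < d) delta i) / 2
  / ((\prod_(i < d) Cu i) * 3 `^ (\sum_(i < d) delta i)).

Lemma sel_const_gt0 : 0 < sel_const.
Proof.
rewrite /sel_const !divr_gt0 // mulr_gt0 ?powR_gt0 ?prodr_gt0_ord //; lra.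
Qed.

(** Cutting the levels at a finite [M] loses at most half of the lower mass bound for the ball of
    radius r/4, and the tripled selected boxes cover what remains. The radius r/4 leaves room for
    the boxes inside the ball of radius r. *)
Lemma vitali_selection N x0 (r : R) : 0 < r -> r <= r0 ->
  (forall k, (N <= k)%N -> forall i, brad a k i <= r0) ->
  exists n (z : nat -> elt),
    [/\ forall j, (j < n)%N -> admissible N x0 (r / 4) (z j),
        forall i j, (i < j < n)%N -> elt_sep dist a (z i) (z j) &
        sel_const * r `^ (\sum_(i < d) delta i) <= \sum_(j < n) vol delta a (z j).1.1].
Proof.
move=> r_gt0 rr0 hrad; have mc := mass_content mP.1.
set Q := \sum_(i < d) delta i; set cL := \prod_(i < d) cl i; set CU := \prod_(i < d) Cu i.
have cL0 : 0 < cL by exact: prodr_gt0_ord.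
have CU0 : 0 < CU by exact: prodr_gt0_ord.
pose B := oball D x0 (r / 4).
have hB : dborel D B by apply: dborel_ball; exact: prod_metric.
pose bd := cL * (r / 4) `^ Q.
have bd0 : 0 < bd by rewrite mulr_gt0 // powR_gt0 // divr_gt0.
have r4 : 0 < r / 4 by rewrite divr_gt0.
have r40 : r / 4 <= r0 by clearbody bd; lra.
have mB : bd <= mass m B by exact: (prod_ball_lower hdist miP mP cl0 coord_lower).
pose F k := if (N <= k)%N then level_set k else set0.
have hF k : dborel D (F k).
  by rewrite /F; case: ifP => _; [apply: dborel_open; exact: level_set_open|exact: dborel0].
have [|M hM] := @mass_bigcup_approx R X D m mP.1 F (bd / 2) (divr_gt0 bd0 (ltr0n _ 2)) hF.
  rewrite -(full N); congr mass; apply/seteqP; split => x.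
    by move=> [k _]; rewrite /F; case: ifP => // hk hx; exists k.
  by move=> [k hk hx]; exists k => //; rewrite /F hk.
set V := [set x | _] in hM.
have hV : dborel D V by exact: dborel_bigcup_lt.
have mBV : bd / 2 <= mass m (B `&` V).
  have h1 := fcontentID mc hB hV.
  have h2 : mass m (B `\` V) <= mass m (~` V).
    apply: (fcontent_le mc) => //; [exact: dborelD|exact: dborelC].
  have h3 : mass m V + mass m (~` V) = 1.
    by rewrite -mc.2 ?setUCr ?setICr ?(massT mP.1) //; exact: dborelC.
  by clearbody bd; lra.
have hmaxw k : (k < M)%N -> vol delta a M <= vol delta a k.
  by move=> kM; apply: vol_le => //; exact: ltnW.
(* Boxes of level below [M] have at least the volume of level [M], so disjointness bounds their
   number. *)
pose nb := Num.bound (1 / (cL * vol delta a M)).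
have v0 : 0 < cL * vol delta a M by rewrite mulr_gt0 // vol_gt0.
have hnb n z : sep_family (elt_sep dist a) (fun e : elt => (N <= e.1.1 < M)%N) n z -> (n <= nb)%N.
  move=> [hz hsep]; apply: ltnW; rewrite -(ltr_nat R).
  have := @archi_boundP R (1 / (cL * vol delta a M)) (divr_ge0 ler01 (ltW v0)).
  apply: le_lt_trans; rewrite ler_pdivlMr // -[leRHS](massT mP.1).
  apply: le_trans (elt_packing (P := xpredT) hdist miP mP cl0 coord_lower hsep (@dborelT _ _ _) _).
    rewrite mulrCA; apply: ler_wpM2l; first exact: ltW.
    rewrite mulr_natl -[in leLHS](card_ord n) -sumr_const; apply: ler_sum => j _.
    by apply: hmaxw; have /andP[] := hz j (ltn_ord j).
  by move=> j hj _; split => // i; apply: hrad; have /andP[] := hz j hj.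
have hex : exists e : elt, True.
  have [x [k _ [al _ _]]] : exists x, exists2 k, (N <= k)%N & level_set k x.
    apply: contrapT => hno; have := full N.
    rewrite (_ : [set x | _] = set0) ?(fcontent0 mc).
      by move/eqP; rewrite eq_sym oner_eq0.
    by apply/seteqP; split => // x hx; apply: hno; exists x.
  by exists (k, al, x).
have hPQ (e : elt) : admissible N x0 (r / 4) e /\ (e.1.1 < M)%N -> (N <= e.1.1 < M)%N.
  by move=> [[-> _ _ _] ->].
have [n [z [[hz hsep] hcov]]] := greedy_separated (fun e : elt => e.1.1) hPQ hnb hex M.
exists n, z; split => //; first by move=> j /hz[[]].
pose Y j := box dist (z j).2 (fun i => 3 * brad a (z j).1.1 i).
have hY j : dborel D (Y j) by exact: box_borel.
have hBVY x : (B `&` V) x -> exists j, [/\ (j < n)%N, true & Y j x].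
  move=> [Bx [k kM]]; rewrite /F; case: ifP => // Nk [al hal hx].
  have hw i : exists w, Rset i al w /\ dist (x i) w < brad a k i.
    by have /nbhdsetP[w Rw xw] := hx i; exists w.
  pose w i := projT1 (cid (hw i)).
  have hwi i : Rset i al (w i) /\ dist (x i) (w i) < brad a k i by exact: (projT2 (cid (hw i))).
  have hadm : admissible N x0 (r / 4) (k, al, w).
    split => //=; first by move=> i; exact: (hwi i).1.
    by exists x => // i; exact: (hwi i).2.
  have [j [hj hle hs]] := hcov (k, al, w) (conj hadm kM) kM.
  exists j; split => // i; rewrite /oball /=.
  (* The blocking box has level at most k, hence sides at least as long: the centres differ by less
     than two of them, and [x] is less than one further away. This is the factor 3. *)
  have hd : dist ((z j).2 i) (w i) < brad a (z j).1.1 i + brad a k i.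
    by rewrite ltNge; apply/negP => hd; apply: hs; exists i.
  have hrk : brad a k i <= brad a (z j).1.1 i by exact: brad_le.
  have := dist_tri (hdist i) (w i) ((z j).2 i) (x i).
  by rewrite (dist_sym (hdist i) (w i)); have := (hwi i).2; lra.
have h1 : mass m (B `&` V) <= \sum_(j < n) mass m (Y j).
  by apply: (fcontent_cover mc (P := xpredT)) => //; exact: dborelI.
have h2 : \sum_(j < n) mass m (Y j) <= CU * 3 `^ Q * \sum_(j < n) vol delta a (z j).1.1.
  rewrite mulr_sumr; apply: ler_sum => j _.
  have r3 i : 0 < 3 * brad a (z j).1.1 i by rewrite mulr_gt0 // brad_gt0.
  apply: le_trans (box_upper hdist miP mP coord_upper _ r3) _.
  rewrite -/CU -mulrA le_eqVlt; apply/orP; left; apply/eqP; congr (_ * _).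
  rewrite /Q -prodr_powR // -big_split /=; apply: eq_bigr => i _.
  by rewrite powRM //; exact/ltW/brad_gt0.
rewrite /sel_const -/Q -/cL -/CU.
have c0 : 0 < CU * 3 `^ Q by rewrite mulr_gt0 // powR_gt0.
rewrite mulrAC ler_pdivrMr // [leRHS]mulrC.
apply: le_trans h2; apply: le_trans h1; apply: le_trans mBV.
have -> : bd = cL * (1 / 4) `^ Q * r `^ Q.
  rewrite /bd -mulrA -powRM //; last exact: ltW.
  by congr (_ * _ `^ _); lra.
by rewrite le_eqVlt; apply/orP; left; apply/eqP; ring.
Qed.

End Selection.

(** * The redistributed density *)

Lemma geometric_sum_le (R : realType) (q : R) n : 0 < q -> q < 1 ->
  \sum_(k < n) q ^+ k <= 1 / (1 - q).
Proof.
move=> q0 q1; rewrite ler_pdivlMr ?subr_gt0 // mulrC.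
elim: n => [|n IH]; first by rewrite big_ord0 mulr0.
have -> : (1 - q) * \sum_(k < n.+1) q ^+ k = 1 - q ^+ n.+1.
  elim: n.+1 => [|k IHk]; first by rewrite big_ord0 mulr0 expr0 subrr.
  by rewrite big_ord_recr /= mulrDr IHk exprS; ring.
by rewrite gerBl exprn_ge0 // ltW.
Qed.

Section Density.
Variables (R : realType) (d : nat) (T : 'I_d -> Type)
  (dist : forall i, T i -> T i -> R).
Let X := forall i, T i.
Let D : X -> X -> R := prod_dist dist.
Variables (mi : forall i, set (T i) -> \bar R) (delta a t : 'I_d -> R) (kappa : R)
  (m : set X -> \bar R) (J : Type) (Rset : forall i, J -> set (T i)) (lev : J -> nat -> Prop).
Arguments mi : clear implicits.
Arguments Rset : clear implicits.
Hypothesis d0 : (0 < d)%N.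
Hypothesis hdist : forall i, is_metric (@dist i).
Hypothesis miP : forall i, borel_prob_measure (@dist i) (mi i).
Hypothesis mP : is_product_measure dist mi m.
Hypotheses (delta0 : forall i, 0 < delta i) (a0 : forall i, 0 < a i) (t0 : forall i, 0 < t i).
Variables (cl Cu c2 c3 : 'I_d -> R) (r0 r1 : R).
Hypotheses (cl0 : forall i, 0 < cl i) (Cu0 : forall i, 0 < Cu i)
  (c20 : forall i, 0 < c2 i) (c30 : forall i, 0 < c3 i) (r00 : 0 < r0) (r10 : 0 < r1).
Hypothesis coord_lower : forall i x (r : R), 0 < r -> r <= r0 ->
  cl i * r `^ delta i <= mass (mi i) (oball (@dist i) x r).
Hypothesis coord_upper : forall i x (r : R), 0 < r ->
  mass (mi i) (oball (@dist i) x r) <= Cu i * r `^ delta i.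
Hypothesis scaling : forall i alpha x (eps r : R), Rset i alpha x -> 0 < eps -> eps < r -> r <= r1 ->
  c2 i * r `^ (delta i * kappa) * eps `^ (delta i * (1 - kappa)) <=
  mass (mi i) (oball (@dist i) x r `&` nbhdset (@dist i) (Rset i alpha) eps) <=
  c3 i * r `^ (delta i * kappa) * eps `^ (delta i * (1 - kappa)).

Let elt := (nat * J * X)%type.

Definition elt_piece (e : elt) : set X :=
  drect (fun i => piece dist a t Rset e.1.2 (e.2 i) e.1.1).

Lemma elt_piece_borel e : dborel D (elt_piece e).
Proof. by apply: dborel_open; apply: dopen_drect => // i; exact: piece_open. Qed.

(** Level 0 is excluded since its scale is 1, so that other radii are not powers of it. *)
Definition usable (e : elt) : Prop :=
  [/\ (0 < e.1.1)%N, forall i, Rset i e.1.2 (e.2 i),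
      forall i, brad a e.1.1 i <= r0 & forall i, brad a e.1.1 i <= r1 / 3].

Lemma mass_elt_piece e : mass m (elt_piece e) =
  \prod_(i < d) mass (mi i) (piece dist a t Rset e.1.2 (e.2 i) e.1.1).
Proof. by apply: mass_drect => // i; exact: piece_borel. Qed.

Lemma elt_piece_gt0 e : usable e -> 0 < mass m (elt_piece e).
Proof.
move=> [_ hR _ hr]; rewrite mass_elt_piece; apply: prodr_gt0_ord => i.
have hr1 : brad a e.1.1 i <= r1 by have := hr i; have := brad_gt0 a e.1.1 i; lra.
exact: (piece_gt0 a0 t0 c20 scaling (hR i) hr1).
Qed.

Let CP := \prod_(i < d) piece_const delta a t kappa c2 c3 Cu i.
Let Q := \sum_(i < d) delta i.
Let K1 := (\prod_(i < d) Cu i) * 3 `^ Q / (\prod_(i < d) cl i).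

Lemma piece_const_prod_gt0 : 0 < CP.
Proof.
apply: prodr_gt0_ord => i.
by have [h _ _] := piece_const_ge delta a t kappa c20 c30 Cu0 i; lra.
Qed.

Lemma packing_const_gt0 : 0 < K1.
Proof. by rewrite divr_gt0 ?mulr_gt0 ?powR_gt0 ?prodr_gt0_ord //; lra. Qed.

Lemma elt_piece_ratio e x A : usable e -> 0 < A ->
  mass m (oball D x (dyadic e.1.1 `^ A) `&` elt_piece e)
    * (\prod_(i < d) Num.max (dyadic e.1.1 `^ A) (brad a e.1.1 i) `^ delta i) <=
  CP * dyadic e.1.1 `^ (total_exp delta a t kappa A) * mass m (elt_piece e).
Proof.
move=> [_ hR _ hr] A0.
have rho0 : 0 < dyadic e.1.1 `^ A :> R by apply: powR_gt0; exact: dyadic_gt0.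
rewrite oball_drect //.
set Bi := fun i => oball (@dist i) (x i) (dyadic e.1.1 `^ A).
set Pi := fun i => piece dist a t Rset e.1.2 (e.2 i) e.1.1.
have -> : drect Bi `&` elt_piece e = drect (fun i => Bi i `&` Pi i).
  apply/seteqP; split=> [y [h1 h2] i|y h]; first by split; [exact: h1|exact: h2].
  by split=> i; have [] := h i.
rewrite (mass_drect miP mP); last first.
  by move=> i; apply: dborelI; [exact: dborel_ball|exact: piece_borel].
rewrite mass_elt_piece /total_exp -prodr_powR; last exact: dyadic_gt0.
rewrite /CP -!big_split /=; apply: ler_prod => i _; apply/andP; split.
  apply: mulr_ge0; last exact: powR_ge0.
  apply: (fcontent_ge0 (mass_content (miP i))).
  by apply: dborelI; [exact: dborel_ball|exact: piece_borel].
exact: (piece_ratio hdist miP a0 t0 c20 c30 Cu0 coord_upper scaling (x i) (hR i) (hr i) A0).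
Qed.

Definition meets (A : set X) (e : elt) : bool := `[< exists y, A y /\ elt_piece e y >].

(** Along each axis a box whose piece meets the ball reaches less than rho + brad/2 + brad from [x],
    hence lies in the box of radii 3 w, where disjointness bounds the total volume. *)
Lemma meets_packing n (z : nat -> elt) (P : pred nat) x rho (w : 'I_d -> R) :
  (forall j, (j < n)%N -> usable (z j)) ->
  (forall i j, (i < j < n)%N -> elt_sep dist a (z i) (z j)) ->
  0 < rho -> (forall i, rho <= w i) ->
  (forall j, (j < n)%N -> P j -> forall i, brad a (z j).1.1 i <= w i) ->
  \sum_(j < n | P j && meets (oball D x rho) (z j)) vol delta a (z j).1.1 <=
    K1 * \prod_(i < d) w i `^ delta i.
Proof.
move=> hz hsep rho0 hw hP.
have cL0 : 0 < \prod_(i < d) cl i by exact: prodr_gt0_ord.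
have w0 i : 0 < w i by exact: lt_le_trans (hw i).
rewrite /K1 mulrAC ler_pdivlMr // mulrC.
pose A := box dist x (fun i => 3 * w i).
apply: le_trans (elt_packing (P := fun j => P j && meets (oball D x rho) (z j)) (A := A)
  hdist miP mP cl0 coord_lower hsep _ _) _.
- exact: box_borel.
- move=> j hj /andP[Pj /asboolP[y [yB yP]]]; have [_ _ h _] := hz j hj; split => //.
  move=> v hv i; move: yB; rewrite oball_drect // => /(_ i) yB.
  have [yPi _] := yP i; have vi := hv i; have := hP j hj Pj i; have := hw i.
  move: yB yPi vi; rewrite /oball /=.
  have := dist_tri (hdist i) ((z j).2 i) (x i) (v i).
  have := dist_tri (hdist i) (y i) (x i) ((z j).2 i).
  rewrite (dist_sym (hdist i) (y i) ((z j).2 i)); have := brad_gt0 a (z j).1.1 i; lra.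
- have w30 i : 0 < 3 * w i by rewrite mulr_gt0.
  apply: le_trans (box_upper hdist miP mP coord_upper x w30) _.
  rewrite -[leRHS]mulrA le_eqVlt; apply/orP; left; apply/eqP; congr (_ * _).
  rewrite /Q -prodr_powR // -big_split /=; apply: eq_bigr => i _.
  by rewrite powRM //; exact: ltW.
Qed.

(** The mass that [B] receives when [vol] is spread uniformly over the piece, before normalisation
    by the total volume. *)
Definition density_term (B : set X) (e : elt) : R :=
  vol delta a e.1.1 * mass m (B `&` elt_piece e) / mass m (elt_piece e).

Lemma density_term_le B e : dborel D B -> usable e ->
  density_term B e <= if meets B e then vol delta a e.1.1 else 0.
Proof.
move=> hB he; have p0 := elt_piece_gt0 he; have hP := elt_piece_borel e.
have mc := mass_content mP.1.
rewrite /density_term /meets; case: asboolP => [_|hno].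
  rewrite -mulrA ler_piMr //; first by apply: ltW; exact: vol_gt0.
  rewrite ler_pdivrMr // mul1r; apply: (fcontent_le mc) => //; exact: dborelI.
rewrite (_ : B `&` elt_piece e = set0) ?(fcontent0 mc) ?mulr0 ?mul0r //.
by apply/seteqP; split => // y [? ?]; apply: hno; exists y.
Qed.

(** Each term is at most the volume of its box, so a single packing with w = rho treats all these
    levels at once. *)
Lemma low_density_sum n (z : nat -> elt) (P : pred nat) x rho :
  (forall j, (j < n)%N -> usable (z j)) ->
  (forall i j, (i < j < n)%N -> elt_sep dist a (z i) (z j)) -> 0 < rho ->
  (forall j, (j < n)%N -> P j -> forall i, brad a (z j).1.1 i <= rho) ->
  \sum_(j < n | P j) density_term (oball D x rho) (z j) <= K1 * rho `^ Q.
Proof.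
move=> hz hsep rho0 hP.
rewrite /Q -prodr_powR //.
apply: le_trans (meets_packing x (w := fun=> rho) hz hsep rho0 (fun=> lexx _) hP).
rewrite big_mkcondr /=; apply: ler_sum => j Pj.
apply: density_term_le; last exact: hz.
by apply: dborel_ball; exact: prod_metric.
Qed.

(** With w = max(rho, brad) and W the product of the w_i^delta_i, each piece gives at most CP u^E /
    W times its volume, E being [total_exp]; the boxes that meet the ball have total volume at most
    K1 W, and W cancels. *)
Lemma level_density_sum n (z : nat -> elt) (k : nat) x A :
  (forall j, (j < n)%N -> usable (z j)) ->
  (forall i j, (i < j < n)%N -> elt_sep dist a (z i) (z j)) -> 0 < A ->
  \sum_(j < n | (z j).1.1 == k) density_term (oball D x (dyadic k `^ A)) (z j) <=
    K1 * CP * dyadic k `^ (total_exp delta a t kappa A).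
Proof.
move=> hz hsep A0; set rho : R := dyadic k `^ A.
have rho0 : 0 < rho by apply: powR_gt0; exact: dyadic_gt0.
pose w i := Num.max rho (brad a k i).
pose W := \prod_(i < d) w i `^ delta i.
have W0 : 0 < W.
  by apply: prodr_gt0_ord => i; apply: powR_gt0; rewrite lt_max rho0.
have := meets_packing (P := fun j => (z j).1.1 == k) (w := w) x hz hsep rho0.
have hw1 i : rho <= w i by rewrite /w le_max lexx.
have hw2 j : (j < n)%N -> (z j).1.1 == k -> forall i, brad a (z j).1.1 i <= w i.
  by move=> _ /eqP -> i; rewrite /w le_max lexx orbT.
move=> /(_ hw1 hw2); rewrite -/W => hpack.
set E : R := dyadic k `^ _.
have E0 : 0 < E by apply: powR_gt0; exact: dyadic_gt0.
have CP0 := piece_const_prod_gt0.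
have hB : dborel D (oball D x rho) by apply: dborel_ball; exact: prod_metric.
apply: (@le_trans _ _ (CP * E / W *
   \sum_(j < n | ((z j).1.1 == k) && meets (oball D x rho) (z j)) vol delta a (z j).1.1)).
  rewrite mulr_sumr big_mkcondr /=; apply: ler_sum => j /eqP jk.
  have uz := hz j (ltn_ord j); have p0 := elt_piece_gt0 uz.
  have := density_term_le hB uz; case: ifP => // _ _.
  rewrite /density_term -mulrA [leRHS]mulrC; apply: ler_wpM2l.
    by apply: ltW; exact: vol_gt0.
  rewrite ler_pdivrMr // mulrAC ler_pdivlMr //.
  have := elt_piece_ratio x uz A0; rewrite jk; exact.
apply: le_trans (ler_wpM2l _ hpack) _.
  by rewrite divr_ge0 ?mulr_ge0 // ltW.
rewrite le_eqVlt; apply/orP; left; apply/eqP.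
by field; rewrite gt_eqF.
Qed.

Variables (s s' : R).
Hypotheses (s0 : 0 < s) (ss' : s < s')
  (hbp : forall b, s' * breakpoint a t b <= total_exp delta a t kappa (breakpoint a t b)).

Lemma density_sum : exists2 K, 0 < K & forall n (z : nat -> elt) x (rho : R),
  (forall j, (j < n)%N -> usable (z j)) ->
  (forall i j, (i < j < n)%N -> elt_sep dist a (z i) (z j)) ->
  0 < rho -> rho < 1 ->
  \sum_(j < n) density_term (oball D x rho) (z j) <= K * rho `^ s.
Proof.
have [amin am0 ham] := exists_pos_le_ord a0.
have CP0 := piece_const_prod_gt0; have K10 := packing_const_gt0.
pose ep := (s' - s) * amin.
have ep0 : 0 < ep by rewrite mulr_gt0 // subr_gt0.
(* The slack u^ep at level k is q^k, whence a series independent of how many levels occur. *)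
pose q : R := (1 / 2) `^ ep.
have q0 : 0 < q by apply: powR_gt0; lra.
have q1 : q < 1.
  have : q < 1 `^ ep by apply: gt0_ltr_powR; rewrite ?nnegrE //; lra.
  by rewrite powR1.
have dq k : dyadic k `^ ep = q ^+ k.
  by rewrite /dyadic /q -powR_mulrn ?powR_ge0 // -powR_mulrn; [rewrite powRAC|lra].
have q2 : 0 < 1 / (1 - q) by rewrite divr_gt0 // subr_gt0.
exists (K1 + K1 * CP * (1 / (1 - q))).
  by rewrite addr_gt0 // mulr_gt0 // mulr_gt0.
move=> n z x rho hz hsep rho0 rho1.
pose low j := [forall i : 'I_d, brad a (z j).1.1 i <= rho].
have sQ : s <= Q by apply: le_trans (ltW ss') _; exact: (exp_le_total_delta d0 a0 hbp).
rewrite (bigID (fun j : 'I_n => low j)) /= mulrDl; apply: lerD.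
  apply: le_trans (low_density_sum (P := low) x hz hsep rho0 _) _.
    by move=> j hj /forallP.
  by apply: ler_wpM2l; [exact: ltW|apply: ger_powR => //; rewrite rho0 ltW].
pose M := \max_(j < n) (z j).1.1.
have hM (j : 'I_n) : ((z j).1.1 < M.+1)%N by rewrite ltnS; exact: (leq_bigmax j).
(* All levels are at most [M], so [inord] does not merge any of them. *)
rewrite (partition_big (fun j : 'I_n => (inord (z j).1.1 : 'I_M.+1)) xpredT) //=.
apply: (@le_trans _ _ (\sum_(k < M.+1) K1 * CP * rho `^ s * q ^+ k)); last first.
  rewrite -mulr_sumr mulrAC; apply: ler_wpM2r; first exact: powR_ge0.
  apply: ler_wpM2l; last exact: geometric_sum_le.
  by apply: ltW; exact: mulr_gt0.
apply: ler_sum => k _.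
have hr0 : 0 <= K1 * CP * rho `^ s * q ^+ k.
  apply: mulr_ge0; last by rewrite exprn_ge0 // ltW.
  by apply: mulr_ge0; [apply: ltW; exact: mulr_gt0|exact: powR_ge0].
have [[j [jlow jk]]|hno] := pselect (exists j : 'I_n, ~~ low j /\ (z j).1.1 = k); last first.
  rewrite big1 // => j /andP[jl /eqP jk]; case: hno; exists j; split => //.
  by rewrite -jk inordK.
have k0 : (0 < k)%N by rewrite -jk; have [] := hz j (ltn_ord j).
have u0 := dyadic_gt0 R k; have u1 := dyadic_lt1 R k0.
pose A := ln rho / ln (dyadic k).
have lnu : ln (dyadic k) < 0 :> R by apply: ln_lt0; rewrite u0 u1.
have lnr : ln rho < 0 by apply: ln_lt0; rewrite rho0 rho1.
have rhoE : rho = dyadic k `^ A.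
  apply: ln_inj; rewrite ?posrE //; first exact: powR_gt0.
  by rewrite ln_powR /A divfK // lt_eqF.
(* Some side u^a_i exceeds rho = u^A because j is not [low]; as u < 1, this gives A >= a_i. *)
have A_am : amin <= A.
  move/forallPn: jlow => [i]; rewrite -ltNge jk rhoE /brad => h.
  apply: le_trans (ham i) _; rewrite leNgt; apply/negP => Aa.
  have : dyadic k `^ a i <= dyadic k `^ A :> R.
    by apply: ger_powR; [rewrite u0 ltW|exact: ltW].
  by rewrite leNgt h.
have A0 : 0 < A by exact: lt_le_trans A_am.
apply: (@le_trans _ _ (K1 * CP * dyadic k `^ total_exp delta a t kappa A)).
  rewrite rhoE; apply: le_trans (level_density_sum k x hz hsep A0).
  rewrite -rhoE big_mkcond [leRHS]big_mkcond /=; apply: ler_sum => j' _.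
  have hinord : (inord (z j').1.1 == k) = ((z j').1.1 == k).
    by rewrite -val_eqE /= inordK.
  rewrite hinord; case: (low j') => //=; case: ifP => // _.
  rewrite /density_term divr_ge0 ?mulr_ge0 //.
  - by apply: ltW; exact: vol_gt0.
  - apply: (fcontent_ge0 (mass_content mP.1)); apply: dborelI; last exact: elt_piece_borel.
    by apply: dborel_ball; exact: prod_metric.
  - by apply: (fcontent_ge0 (mass_content mP.1)); exact: elt_piece_borel.
rewrite -[leRHS]mulrA; apply: ler_wpM2l; first by apply: ltW; exact: mulr_gt0.
rewrite -dq {1}rhoE -powRrM -gt0_powRD //.
apply: ger_powR; first by rewrite u0 ltW.
by rewrite mulrC; apply: total_exp_slack.
Qed.

Definition target_set (N : nat) : set X :=
  [set x | exists k alpha, [/\ (N <= k)%N, lev alpha k &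
     forall i, nbhdset (@dist i) (Rset i alpha) ((dyadic k / 2) `^ (a i + t i)) (x i)]].

(** Twice the [thickness] is the target radius, and the distances r/4, brad, brad/2 and brad/2 add
    up to less than r. *)
Lemma elt_piece_nbd N x0 (r : R) e : admissible dist a Rset lev N x0 (r / 4) e ->
  0 < r -> (forall i, brad a e.1.1 i <= r / 4) ->
  exists2 eta, 0 < eta & nbd D (elt_piece e) eta `<=` oball D x0 r `&` target_set N.
Proof.
move=> [hN hlev hR [p px0 hp]] r_gt0 hr.
have [e1 e10 he1] := exists_pos_le_ord (fun i => divr_gt0 (brad_gt0 a e.1.1 i) (ltr0n R 2)).
have [e2 e20 he2] := exists_pos_le_ord (thickness_gt0 a t e.1.1).
have e120 : 0 < Num.min e1 e2 by rewrite lt_min e10.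
exists (Num.min e1 e2) => // y [w hw yw].
have yw' i : dist (y i) (w i) < e1 /\ dist (y i) (w i) < e2.
  have := (prod_dist_lt dist y w e120).1 yw i; rewrite lt_min => /andP[? ?]; split => //.
split.
  rewrite oball_drect // => i; rewrite /oball /=.
  move: px0; rewrite oball_drect ?divr_gt0 // => /(_ i); rewrite /oball /= => xp.
  have [zw _] := hw i; move: zw; rewrite /oball /= => zw.
  have := dist_tri (hdist i) (p i) (x0 i) (y i).
  have := dist_tri (hdist i) (e.2 i) (p i) (y i).
  have := dist_tri (hdist i) (w i) (e.2 i) (y i).
  rewrite (dist_sym (hdist i) (w i) (y i)).
  have := hr i; have := hp i; have [] := yw' i; have := he1 i; lra.
exists e.1.1, e.1.2; split => // i; apply/nbhdsetP.
have [_ /nbhdsetP[v Rv wv]] := hw i; exists v => //.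
have := dist_tri (hdist i) (w i) (y i) v; have [_ h2] := yw' i; have h3 := he2 i.
by move: wv h3; rewrite /thickness; lra.
Qed.

Hypothesis full : forall N, mass m [set x | exists2 k, (N <= k)%N & level_set dist a Rset lev k x] = 1.

Theorem redistributable_target : redistributable D m Q target_set s.
Proof.
have mc := mass_content mP.1.
have [K K0 hK] := density_sum.
have sc0 : 0 < sel_const delta cl Cu by exact: sel_const_gt0.
(* The quotient comes from the total volume being at least [sel_const] times r^Q; the added 1 covers
   rho >= 1, where the mass is at most 1. *)
pose C := K / sel_const delta cl Cu + 1.
have hKs : 0 < K / sel_const delta cl Cu by exact: divr_gt0.
have C1 : 1 <= C by rewrite /C; lra.
have CK : K / sel_const delta cl Cu <= C by rewrite /C; lra.
have Q0 : 0 < Q.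
  by apply: lt_le_trans (le_trans (ltW ss') (exp_le_total_delta d0 a0 hbp)).
clearbody C; exists C, (Num.min 1 r0); split; first lra; first by rewrite lt_min ltr01.
move=> x0 r N r_gt0; rewrite le_min => /andP[r1' rr0].
have hmin : 0 < Num.min (Num.min r0 (r1 / 3)) (r / 4).
  by rewrite !lt_min r00 !divr_gt0.
have [N1 hN1] := brad_small a0 hmin.
pose N' := maxn N (maxn N1 1).
have hN' k : (N' <= k)%N -> [/\ (N <= k)%N, (0 < k)%N, forall i, brad a k i <= r0,
    forall i, brad a k i <= r1 / 3 & forall i, brad a k i <= r / 4].
  rewrite !geq_max => /and3P[h1 h2 h3]; split => // i; have := hN1 k h2 i;
    by rewrite !le_min => /andP[/andP[]].
have hrad k : (N' <= k)%N -> forall i, brad a k i <= r0 by move=> /hN'[].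
have [n [z [hadm hsep hsum]]] :=
  vitali_selection hdist miP mP cl0 Cu0 coord_lower coord_upper delta0 a0 full x0 r_gt0 rr0 hrad.
have hz j : (j < n)%N -> usable (z j).
  by move=> hj; have [/hN'[_ ? ? ? _] _ ? _] := hadm j hj.
have hnbd j : (j < n)%N -> exists2 eta, 0 < eta &
    nbd D (elt_piece (z j)) eta `<=` oball D x0 r `&` target_set N.
  move=> hj; have [hk hlev hR hx] := hadm j hj; have [hNk _ _ _ hr4] := hN' _ hk.
  exact: elt_piece_nbd.
have hnbd' j : exists eta, 0 < eta /\ ((j < n)%N ->
    nbd D (elt_piece (z j)) eta `<=` oball D x0 r `&` target_set N).
  case: (ltnP j n) => [/hnbd[eta ? ?]|_]; [by exists eta|by exists 1].
have {hnbd hnbd'}[et het] := choice hnbd'.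
have [e e0 he] := exists_pos_le (fun i (_ : (i < n)%N) => (het i).1).
pose Z := \sum_(j < n) vol delta a (z j).1.1.
have rQ0 : 0 < r `^ Q by exact: powR_gt0.
have Z0 : 0 < Z by apply: lt_le_trans hsum; rewrite mulr_gt0.
(* Density on piece j for which this piece receives the fraction vol/Z of a unit mass. *)
pose W j := vol delta a (z j).1.1 / mass m (elt_piece (z j)) / Z.
have W0 j : (j < n)%N -> 0 < W j.
  by move=> hj; rewrite !divr_gt0 ?elt_piece_gt0 ?vol_gt0 //; exact: hz.
pose nu A := \sum_(j < n) W j * mass m (A `&` elt_piece (z j)).
have nuc : fcontent D nu.
  apply: (fcontent_sum (P := xpredT) (mu := fun j A => mass m (A `&` elt_piece (z j)))).
    by move=> j hj _; exact/ltW/W0.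
  by move=> j _ _; apply: fcontent_restrict => //; exact: elt_piece_borel.
have nuT : nu setT = 1.
  rewrite /nu (eq_bigr (fun j : 'I_n => vol delta a (z j).1.1 / Z)).
    by rewrite -mulr_suml divff // gt_eqF.
  move=> j _; have p0 := elt_piece_gt0 (hz j (ltn_ord j)).
  by rewrite setTI /W; field; rewrite !gt_eqF.
have nuE x rho : nu (oball D x rho) = (\sum_(j < n) density_term (oball D x rho) (z j)) / Z.
  rewrite /nu mulr_suml; apply: eq_bigr => j _.
  have p0 := elt_piece_gt0 (hz j (ltn_ord j)).
  by rewrite /W /density_term; field; rewrite !gt_eqF.
exists nu, [set y | exists2 j, (j < n)%N & elt_piece (z j) y], e, (\sum_(j < n) W j).
split; split => //.
- move=> A hA; rewrite mulr_suml; apply: ler_sum => j _.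
  apply: ler_wpM2l; first exact/ltW/W0.
  by apply: (fcontent_le mc) => //; apply: dborelI => //; exact: elt_piece_borel.
- move=> A hA hAS; rewrite /nu big1 // => j _.
  rewrite (_ : A `&` _ = set0) ?(fcontent0 mc) ?mulr0 //.
  apply/seteqP; split => y //= -[Ay Py].
  suff: (A `&` [set y | exists2 j, (j < n)%N & elt_piece (z j) y]) y by rewrite hAS.
  by split => //; exists j.
- move=> y [w [j hj Pw] yw]; apply: (het j).2 => //.
  by exists w => //; apply: lt_le_trans yw (he j hj).
- move=> x rho rho0; rewrite ler_pdivlMr //.
  have nu1 : nu (oball D x rho) <= 1.
    rewrite -nuT; apply: (fcontent_le nuc) => //; last exact: dborelT.
    by apply: dborel_ball; exact: prod_metric.
  have rQ1 : r `^ Q <= 1.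
    by rewrite -[leRHS](powRr0 r); apply: ger_powR; [rewrite r_gt0|exact: ltW].
  have [rho1|rho1] := ltP rho 1; last first.
    have h1 : 1 <= rho `^ s by rewrite -[leLHS](powRr0 rho); apply: ler_powR => //; exact: ltW.
    apply: (@le_trans _ _ (1 * 1)); last by apply: ler_pM.
    by apply: ler_pM => //; [apply: (fcontent_ge0 nuc); apply: dborel_ball; exact: prod_metric|exact: ltW].
  rewrite nuE mulrAC ler_pdivrMr //.
  have h1 := hK n z x rho hz hsep rho0 rho1.
  apply: le_trans (ler_wpM2r (ltW rQ0) h1) _.
  apply: (@le_trans _ _ (C * rho `^ s * (sel_const delta cl Cu * r `^ Q))); last first.
    by apply: ler_wpM2l => //; rewrite mulr_ge0 ?powR_ge0 //; lra.
  have -> : C * rho `^ s * (sel_const delta cl Cu * r `^ Q) =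
    (C * sel_const delta cl Cu) * rho `^ s * r `^ Q by ring.
  apply: ler_wpM2r; first exact: ltW.
  apply: ler_wpM2r; first exact: powR_ge0.
  by rewrite -ler_pdivrMr.
Qed.

End Density.

(** * Lower bound for the dimension *)

Lemma finite_set_ubound (R : realType) (J : Type) (f : J -> R) (F : set J) :
  finite_set F -> exists B, forall al, F al -> f al <= B.
Proof.
move=> /(finite_image f)/finite_seqP[s hs].
exists (\sum_(y <- s) `|y|) => al Fal.
have : f al \in s.
  by have : [set` s] (f al) by rewrite -hs; exists al.
move=> fs; rewrite (big_rem _ fs) /=; apply: le_trans (ler_norm _) _.
by rewrite lerDl sumr_ge0.
Qed.

Lemma dyadic_bracket (R : realType) (v : R) : 0 < v -> v <= 1 ->
  exists k, dyadic k / 2 < v <= dyadic k.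
Proof.
move=> v0 v1; have dS k : dyadic k / 2 = dyadic k.+1 :> R.
  by rewrite /dyadic exprS mulrC mul1r.
have hex : exists k, dyadic k.+1 < v.
  by have [N hN] := dyadic_small v0; exists N; apply: hN.
have := ex_minnP hex => -[k hk kmin]; exists k; rewrite dS hk /=.
case: k hk kmin => [|k] hk kmin; first by rewrite /dyadic expr0.
by rewrite leNgt; apply/negP => /kmin; rewrite ltnn.
Qed.

(** * Limsup sets and dyadic levels *)

Section Limsup.
Variables (R : realType) (d : nat) (T : 'I_d -> Type)
  (dist : forall i, T i -> T i -> R).
Let X := forall i, T i.
Let D : X -> X -> R := prod_dist dist.
Variables (J : Type) (beta : J -> R) (rho : R -> R)
  (Rset : forall i, J -> set (T i)).
Arguments Rset : clear implicits.
Hypothesis hdist : forall i, is_metric (@dist i).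
Hypothesis beta0 : forall alpha, 0 < beta alpha.
Hypothesis beta_fin : forall M : R, 1 < M -> finite_set [set alpha | beta alpha < M].
Hypothesis rho0 : forall u, 0 < u -> 0 < rho u.
Hypothesis rho_cvg : rho x @[x --> +oo] --> 0.

Definition level (alpha : J) (k : nat) : Prop :=
  dyadic k / 2 < rho (beta alpha) <= dyadic k.

Definition target (b : 'I_d -> R) alpha : set X :=
  drect (fun i => nbhdset (@dist i) (Rset i alpha) (rho (beta alpha) `^ b i)).

Lemma limsup_frequently b x (M : R) : limsup_set dist Rset beta rho b x ->
  exists2 alpha, M <= beta alpha & target b alpha x.
Proof.
move=> hx; apply: contrapT => hno; apply: hx.
have h1 : 1 < Num.max M 2 by rewrite lt_max; apply/orP; right; lra.
apply: sub_finite_set (beta_fin h1) => al hal /=.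
rewrite ltNge; apply/negP => hM; apply: hno; exists al => //.
by apply: le_trans hM; rewrite le_max lexx.
Qed.

(** Integer thresholds on [beta] exhibit the set as a countable intersection of open sets: beyond
    every threshold some alpha remains exactly when infinitely many occur. *)
Lemma limsup_borel b : dborel D (limsup_set dist Rset beta rho b).
Proof.
have -> : limsup_set dist Rset beta rho b = \bigcap_(n : nat)
    \bigcup_(alpha in [set alpha | n%:R <= beta alpha]) target b alpha.
  apply/seteqP; split => x.
    by move=> hx n _; have [al h1 h2] := limsup_frequently n%:R hx; exists al.
  move=> hx hfin; have [B hB] := finite_set_ubound beta hfin.
  have [n hn] : exists n : nat, B < n%:R.
    exists (Num.bound `|B|); apply: le_lt_trans (ler_norm _) _.
    exact: archi_boundP.
  have [al /= hal hx'] := hx n I.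
  by have := hB al hx'; rewrite leNgt (lt_le_trans hn hal).
apply: dborel_bigcap => n; apply: dborel_open; apply: dopen_bigcup => al _.
by apply: dopen_drect => // i; exact: dopen_nbhdset.
Qed.

(** Large [beta alpha] makes [rho (beta alpha)] smaller than 2^-N, hence the level at least N;
    rounding up only enlarges the neighbourhoods. *)
Lemma limsup_level_set (a : 'I_d -> R) N x : (forall i, 0 < a i) ->
  limsup_set dist Rset beta rho a x ->
  exists2 k, (N <= k)%N & level_set dist a Rset level k x.
Proof.
move=> a0 hx.
have [M [_ hM]] := (cvgrPdist_lt _ _).1 rho_cvg (dyadic N) (dyadic_gt0 R N).
have [al hal htar] := limsup_frequently (M + 1) hx.
have rN : rho (beta al) < dyadic N.
  have := hM (beta al); rewrite sub0r normrN => h.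
  by apply: le_lt_trans (ler_norm _) (h _); lra.
have rp := rho0 (beta0 al).
have [k hk] := dyadic_bracket rp (le_trans (ltW rN) (dyadic_le1 R N)).
have /andP[k1 k2] := hk.
exists k.
  rewrite leqNgt; apply/negP => kN.
  have := dyadic_le R kN; rewrite leNgt.
  have -> : dyadic k.+1 = dyadic k / 2 :> R by rewrite /dyadic exprS mulrC mul1r.
  by rewrite (lt_trans k1 rN).
exists al => // i; apply: nbhdsetS (htar i).
apply: ge0_ler_powR => //; rewrite ?nnegrE; apply: ltW => //.
exact: dyadic_gt0.
Qed.

(** If only finitely many alpha occurred, 1/rho(beta_alpha) would be bounded over them, while deep
    enough levels still provide an alpha exceeding the bound. *)
Lemma target_set_limsup (a t : 'I_d -> R) : (forall i, 0 < a i) -> (forall i, 0 < t i) ->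
  \bigcap_N target_set dist a t Rset level N `<=`
  limsup_set dist Rset beta rho (fun i => a i + t i).
Proof.
move=> a0 t0 x hx hfin.
have [B hB] := finite_set_ubound (fun al => (rho (beta al))^-1) hfin.
have B0 : 0 < (`|B| + 1)^-1 by rewrite invr_gt0; have := normr_ge0 B; lra.
have [N hN] := dyadic_small B0.
have [k [al [Nk /andP[k1 k2] hal]]] := hx N I.
have rp := rho0 (beta0 al).
have : (rho (beta al))^-1 <= B.
  apply: hB => i; apply: nbhdsetS (hal i).
  apply: ge0_ler_powR; rewrite ?nnegrE; [|by rewrite divr_ge0 // ltW // dyadic_gt0|exact: ltW|exact: ltW].
  by apply: addr_ge0; exact: ltW.
apply/negP; rewrite -ltNge; apply: (@lt_trans _ _ (`|B| + 1)).
  by have := ler_norm B; lra.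
rewrite -[ltLHS]invrK ltf_pV2 ?posrE //.
exact: le_lt_trans k2 (hN k Nk).
Qed.

End Limsup.

Theorem mainTheorem4 (R : realType) (d : nat) (T : 'I_d -> Type)
  (dist : forall i, T i -> T i -> R)
  (mi : forall i, set (T i) -> \bar R) (delta : 'I_d -> R)
  (m : set (forall i, T i) -> \bar R)
  (J : Type) (beta : J -> R) (rho : R -> R) (kappa : R)
  (Rset : forall i, J -> set (T i)) (a t : 'I_d -> R) :
  (0 < d)%N ->
  (forall i, is_metric (@dist i)) ->
  (forall i, bounded_metric (@dist i)) ->
  (forall i, dlocally_compact (@dist i)) ->
  (forall i, borel_prob_measure (@dist i) (mi i)) ->
  is_product_measure dist mi m ->
  (forall i, 0 < delta i) ->
  (forall i, ahlfors_regular (@dist i) (mi i) (delta i)) ->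
  countable [set: J] -> infinite_set [set: J] ->
  (forall alpha, 0 < beta alpha) ->
  (forall M : R, 1 < M -> finite_set [set alpha | beta alpha < M]) ->
  (forall u, 0 < u -> 0 < rho u) ->
  (forall u v, 0 < u -> u <= v -> rho v <= rho u) ->
  rho x @[x --> +oo] --> 0 ->
  0 <= kappa < 1 ->
  (forall i, kappa_scaling dist i (mi i) (delta i) kappa (Rset i)) ->
  (forall i, 0 < a i) ->
  m (limsup_set dist Rset beta rho a) = m setT ->
  (forall i, 0 < t i) ->
  (dim_number delta a t kappa
     <= hausdorff_dim (prod_dist dist) (limsup_set dist Rset beta rho (fun i => (a i + t i)%R)))%E.
Proof.
move=> d0 hdist _ hloc miP mP delta0 hreg _ _ beta0 beta_fin rho0 _ rho_cvg _ hkap a0 hfull t0.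
have [cl [Cu [r0 [cl0 Cu0 r00 hlow hupp]]]] := ahlfors_uniform hdist miP delta0 hreg.
have hq i : exists q : R * R * R, [/\ 0 < q.1.1, 0 < q.1.2, 0 < q.2 &
    forall alpha x eps r, Rset i alpha x -> 0 < eps -> eps < r -> r <= q.2 ->
    q.1.1 * r `^ (delta i * kappa) * eps `^ (delta i * (1 - kappa)) <=
    mass (mi i) (oball (@dist i) x r `&` nbhdset (@dist i) (Rset i alpha) eps) <=
    q.1.2 * r `^ (delta i * kappa) * eps `^ (delta i * (1 - kappa))].
  have [c2 [c3 [r1 [c20 c30 r10 h]]]] := hkap i; exists (c2, c3, r1); split => //.
  move=> al x eps r hx e0 er rr; have := h al x eps r hx e0 er rr.
  rewrite (measure_fin (miP i)) ?lee_fin //.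
  apply: dborelI; first exact: dborel_ball.
  by apply: dborel_open; exact: dopen_nbhdset.
have {hq}[q hq] := choice hq.
have hq0 i : 0 < (q i).2 by have [] := hq i.
have [r1 r10 hr1] := exists_pos_le_ord hq0.
have c20 i : 0 < (q i).1.1 by have [] := hq i.
have c30 i : 0 < (q i).1.2 by have [] := hq i.
have hscal i al x (eps r : R) (hx : Rset i al x) (e0 : 0 < eps) (er : eps < r) (rr : r <= r1) :=
  let: And4 _ _ _ h := hq i in h al x eps r hx e0 er (le_trans rr (hr1 i)).
have hlev N : mass m [set x | exists2 k, (N <= k)%N & level_set dist a Rset (level beta rho) k x] = 1.
  set V := [set x | _].
  have hV : dborel (prod_dist dist) V.
    have -> : V = \bigcup_(k in [set k | (N <= k)%N]) level_set dist a Rset (level beta rho) k.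
      by apply/seteqP; split => x [k h1 h2]; exists k.
    by apply: dborel_open; apply: dopen_bigcup => k _; exact: level_set_open.
  apply/eqP; rewrite eq_le (mass_le1 mP.1 hV) /=.
  have -> : 1 = mass m (limsup_set dist Rset beta rho a) by rewrite /mass hfull mP.1.2.2.2.
  apply: (fcontent_le (mass_content mP.1)) => //; first exact: limsup_borel.
  by move=> x hx; exact: (limsup_level_set beta0 beta_fin rho0 rho_cvg N a0 hx).
apply: le_ereal_inf_tmp => _ [s [s0 hs] <-].
rewrite leNgt; apply/negP => hlt.
have [s' ss' hbp] := dim_number_breakpoints d0 a0 t0 hlt.
(* The gap is split: from [s1] to [s'] it pays for the sum over levels, from [s] to [s1] for the
   iteration. *)
pose s1 := (s + s') / 2.
have ss1 : s < s1 by rewrite /s1; lra.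
have s1s' : s1 < s' by rewrite /s1; lra.
have s10 : 0 < s1 by lra.
have hred := redistributable_target d0 hdist miP mP delta0 a0 t0 cl0 Cu0 c20 c30
  r00 r10 hlow hupp hscal s10 s1s' hbp hlev.
have sQ := exp_le_total_delta d0 a0 hbp.
have sQ' : s <= \sum_(i < d) delta i by lra.
have := redistributable_hausdorff_measure (prod_metric hdist) mP.1 (prodr_gt0_ord cl0)
  (prodr_gt0_ord Cu0) r00 (prod_ball_lower hdist miP mP cl0 hlow)
  (prod_ball_upper hdist miP mP hupp) s0 ss1 sQ' (prod_locally_compact hdist hloc) hred.
apply/negP; rewrite -leNgt -hs.
apply: ge_ereal_sup => _ [e e0 <-].
apply: le_trans (hausdorff_contentS _ _ _ (target_set_limsup beta0 rho0 a0 t0)) _.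
by apply: ereal_sup_ubound; exists e.
Qed.
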